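(* Fix $1\le r<\infty$ and $0<\alpha<0.5$. There exists a constant $L=L(\alpha,r)$, depending only on $\alpha$ and $r$, such that the following holds. Let $\psi$ be a $C^1$ probability density on $[0,1]$ that is $(\alpha,r,\rho)$-nearly unimodal for some density $\rho$ on $[0,1]$. For $c^{-1}\in\{1,2,\ldots\}$, let $g_c$ be the Metropolis--Hastings transition kernel with target $\psi$ and proposal kernel $q_c(x,1,A)=\frac{|A\cap[x-c,x+c]|}{2c}$. Then there is a threshold $C(\psi,\alpha)$ such that the maximum hitting time of $g_c$ satisfies $$t_H(g_c,\alpha)\le L\,c^{-2}$$ for all $c^{-1}\in\{1,2,\dots\}$ with $c^{-1}>C(\psi,\alpha)$.
   Context: $|\cdot|$ is Lebesgue measure. For a density $\rho$ on $[0,1]$ and $0<q<1$, $m(\rho,q)$ is the $q$-th quantile of $\rho$. A density $\rho$ on $[0,1]$ is unimodal if there is $m\in[0,1]$ with $\rho(x)<\rho(y)$ for all $0\le x<y\le m$ and $\rho(x)>\rho(y)$ for all $m\le x<y\le1$. A density $\psi$ on $[0,1]$ is $(\alpha,r,\rho)$-nearly unimodal if (1) $\rho$ is unimodal; (2) $r^{-1}\le\rho(x)/\psi(x)\le r$ for all $x\in[0,1]$; and (3) $r^{-1}\le\psi(x)/\psi(y)\le r$ for all $x,y\in[m(\psi,\alpha),m(\psi,1-\alpha)]$. The Metropolis--Hastings kernel on $[0,1]$ with target $\psi$ and this (symmetric) proposal is $$g_c(x,1,A)=\int_{A\cap[x-c,x+c]}\frac{1}{2c}\min\Big\{1,\frac{\psi(y)}{\psi(x)}\Big\}dy+\mathbf{1}_{x\in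 A}\Big(1-\int_{[0,1]\cap[x-c,x+c]}\frac1{2c}\min\Big\{1,\frac{\psi(y)}{\psi(x)}\Big\}dy\Big)$$ for $x\in[0,1]$ and Borel $A\subset[0,1]$ (proposals outside $[0,1]$ are rejected). For a Markov chain $\{X_t\}_{t\in\mathbb{N}}$ with kernel $g$ and stationary measure $\pi$, $\tau(A)=\min\{t\in\mathbb{N}:X_t\in A\}$ and $t_H(g,\alpha)=\sup\{\mathbb{E}_x[\tau(A)]:x\in[0,1],\ A\text{ Borel},\ \pi(A)\ge\alpha\}$, where $x$ is the starting point; here $\pi(dx)=\psi(x)dx$. *)

(* Defs.v *)
From HB Require Import structures.
From mathcomp Require Import all_boot all_order all_algebra.
From mathcomp Require Import all_classical all_reals all_analysis.

Set Implicit Arguments.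
Unset Strict Implicit.
Unset Printing Implicit Defensive.

Import Order.TTheory GRing.Theory Num.Theory.
Import numFieldNormedType.Exports.

Local Open Scope classical_set_scope.
Local Open Scope ring_scope.

(* Functions and kernels on [0,1] are represented by total functions on R;
   only their values on [0,1] are ever constrained or used. *)

Section densities.
Context {R : realType}.
Implicit Types (f psi rho : R -> R) (alpha q r : R).

Definition density01 rho : Prop :=
  [/\ measurable_fun `[0 : R, 1] rho,
      forall x, x \in `[0, 1] -> 0 <= rho x
    & (\int[lebesgue_measure]_(x in `[0%R, 1%R]) (rho x)%:E = 1)%E].

Definition density_measure psi (A : set R) : \bar R :=
  (\int[lebesgue_measure]_(x in A) (psi x)%:E)%E.

Definition quantile rho q : R :=
  inf [set x | x \in `[0, 1] /\
       (q%:E <= \int[lebesgue_measure]_(y in `[0%R, x]) (rho y)%:E)%E].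

(* C^1 on the closed interval: derivatives at 0 and 1 are one-sided. *)
Definition C1_01 f : Prop :=
  exists df : R -> R,
    {within `[0 : R, 1], continuous df} /\
    forall x, x \in `[0, 1] ->
      (fun y => (f y - f x) / (y - x)) @ within `[0 : R, 1] x^' --> df x.

Definition unimodal rho : Prop :=
  exists m : R, [/\ m \in `[0, 1],
    forall x y, 0 <= x -> x < y -> y <= m -> rho x < rho y
  & forall x y, m <= x -> x < y -> y <= 1 -> rho y < rho x].

(* Since [z / 0 = 0] and [0 < r^-1], the lower bound on [rho x / psi x]
   forces [psi x != 0], as the informal quotient does. *)
Definition nearly_unimodal alpha r rho psi : Prop :=
  [/\ unimodal rho,
      forall x, x \in `[0, 1] -> r^-1 <= rho x / psi x <= r
    & forall x y,
        x \in `[quantile psi alpha, quantile psi (1 - alpha)] ->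
        y \in `[quantile psi alpha, quantile psi (1 - alpha)] ->
        r^-1 <= psi x / psi y <= r].

End densities.

Section metropolis_hastings.
Context {R : realType}.
Local Open Scope ereal_scope.

Definition mh_mass (psi : R -> R) (c x : R) (A : set R) : \bar R :=
  \int[lebesgue_measure]_(y in A `&` `[(x - c)%R, (x + c)%R])
    ((2 * c)^-1 * Num.min 1 (psi y / psi x))%R%:E.

Definition mh_kernel (psi : R -> R) (c x : R) (A : set R) : \bar R :=
  mh_mass psi c x A + (\1_A x)%:E * (1 - mh_mass psi c x `[0%R, 1%R]).

End metropolis_hastings.

Section hitting_times.
Context {R : realType}.
Local Open Scope ereal_scope.

Section chain.
Context {d : measure_display} {Omega : measurableType d}
  {P : probability Omega R}.
Implicit Types X : nat -> {RV P >-> R}.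

(* sigma(X_0, ..., X_n) *)
Definition past X (n : nat) : set (set Omega) :=
  <<s \bigcup_(k in [set k | (k <= n)%N]) g_sigma_algebra_preimage (X k) >>.

(* [X] is a Markov chain on [0,1] with kernel [g], started at [x]:
   P(X_{n+1} in B | X_0, ..., X_n) = g(X_n, B) almost surely, written with
   the defining property of conditional probability. *)
Definition markov_chain (g : R -> set R -> \bar R) (x : R) X : Prop :=
  [/\ forall n w, X n w \in `[0%R, 1%R],
      P [set w | X 0%N w = x] = 1
    & forall n (H : set Omega) (B : set R),
        past X n H -> measurable B -> B `<=` `[0%R, 1%R] ->
        P (H `&` X n.+1 @^-1` B) = \int[P]_(w in H) g (X n w) B].

(* [+oo] when [A] is never visited. *)
Definition hitting_time X (A : set R) (w : Omega) : \bar R :=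
  ereal_inf [set t%:R%:E | t in [set t : nat | A (X t w)]].

End chain.

(* E_x[tau(A)] is taken over every realization of the chain started at x.  Its
   value depends only on the law of the chain, hence only on g, x and A; for
   a probability kernel g a realization exists (Ionescu-Tulcea). *)
Definition max_hitting_time (g : R -> set R -> \bar R) (pi : set R -> \bar R)
    (alpha : R) : \bar R :=
  ereal_sup [set e | exists (d : measure_display) (Omega : measurableType d)
      (P : probability Omega R) (X : nat -> {RV P >-> R}) (x : R) (A : set R),
    [/\ x \in `[0%R, 1%R] /\ markov_chain g x X,
        measurable A, A `<=` `[0%R, 1%R], alpha%:E <= pi A
      & e = \int[P]_w hitting_time X A w]].

End hitting_times.

(* Main.v *)
Require Import Defs.
From mathcomp Require Import all_boot all_order all_algebra.
From mathcomp Require Import all_classical all_reals all_analysis.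
From mathcomp Require Import measurable_realfun ring lra.
Import Order.TTheory GRing.Theory Num.Theory.
Import numFieldNormedType.Exports.
Local Open Scope classical_set_scope.
Local Open Scope ring_scope.

(** For small [c] the chain behaves like the reversible diffusion with density
    [psi], for which the expected hitting time of [A] solves a second order
    equation.  Averaging its right-hand side over [A] gives the potential
    [u' = - G / psi] with [G(x) = pi[0,x] - pi(A n [0,x]) / pi(A)], which
    vanishes at both endpoints.  Unimodality of [rho] gives
    [|G / psi| <= r^2 / alpha].  Take [h = 48 c^-2 u + 576 / alpha] off [A] and
    [h = 0] on [A]: expanding [min(psi x, psi y) (u y - u x)] to second order,
    the first order part is odd in [y - x] and cancels in a symmetric window,
    the second order part gives a drift of order [-1], and the positive
    contribution of the jumps into [A] is absorbed by the drop [576 / alpha].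
    Near an endpoint the window is not symmetric, but there [G] has the right
    sign up to the same absorbed error.  So [h] is a Lyapunov function
    bounded by a multiple of [c^-2].  Only [G / psi] being controlled uniformly
    matters for [L]; all Taylor remainders go into the threshold. *)

(** * Integration of bounded measurable functions over subintervals of the unit interval *)

Section interval_integrals.
Context {R : realType}.
Implicit Types (f g : R -> R) (u v w x y z k M : R).
Local Notation mu := (@lebesgue_measure R).

(** A class closed under sums, products, indicators and primitives, whose members are integrable on
    every subinterval of [[0, 1]]; integrability side conditions thus reduce to closure
    properties. *)
Definition bounded_measurable01 f : Prop :=
  measurable_fun `[0 : R, 1] f /\
  exists M : R, forall x, x \in `[0 : R, 1] -> `|f x| <= M.

Local Notation bm := bounded_measurable01.

Lemma bm_cst k : bm (fun=> k).
Proof. by split; [exact: measurable_cst | exists `|k|]. Qed.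

Lemma bmN f : bm f -> bm (fun x => - f x).
Proof.
move=> [mf [M fM]]; split; first exact: measurableT_comp.
by exists M => x /fM; rewrite normrN.
Qed.

Lemma bmD f g : bm f -> bm g -> bm (fun x => f x + g x).
Proof.
move=> [mf [M fM]] [mg [N gN]]; split; first exact: measurable_funD.
exists (M + N) => x x01; apply: le_trans (ler_normD _ _) _.
by rewrite lerD ?fM ?gN.
Qed.

Lemma bmB f g : bm f -> bm g -> bm (fun x => f x - g x).
Proof. by move=> bf bg; apply: bmD => //; apply: bmN. Qed.

Lemma bmM f g : bm f -> bm g -> bm (fun x => f x * g x).
Proof.
move=> [mf [M fM]] [mg [N gN]]; split; first exact: measurable_funM.
exists (M * N) => x x01; rewrite normrM.
by rewrite ler_pM ?fM ?gN.
Qed.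

Lemma bm_poly2 (a b d p : R) : bm (fun z => a + b * (z - p) + d * (z - p) ^+ 2).
Proof.
have bX : bm (fun z => z - p).
  apply: (bmB id _ _ (bm_cst p)); split; first exact: measurable_id.
  by exists 1 => x; rewrite in_itv/= => /andP[x0 x1]; rewrite ger0_norm.
apply: bmD; first by apply: (bmD _ _ (bm_cst a)); exact: (bmM _ _ (bm_cst b) bX).
by apply: (bmM _ _ (bm_cst d)); exact: (bmM _ _ bX bX).
Qed.

Lemma bm_indic (A : set R) : measurable A -> bm (\1_A).
Proof.
move=> mA; split; first exact: measurable_indic.
exists 1 => x _; rewrite /indic; by case: (_ \in _); rewrite /= ?normr1 ?normr0.
Qed.

Lemma bm_min1 f : bm f -> bm (fun x => Num.min 1 (f x)).
Proof.
move=> [mf [M fM]]; split.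
  by apply: measurable_minr => //; exact: measurable_cst.
exists (1 + M) => x /fM fx; rewrite minElt; case: ifPn => _.
  by rewrite normr1 lerDl (le_trans _ fx).
by rewrite (le_trans fx)// lerDr.
Qed.

Lemma bm_continuous f : {within `[0 : R, 1], continuous f} -> bm f.
Proof.
move=> cf; split; first exact: subspace_continuous_measurable_fun.
have [a a01 fa] := EVT_max ler01 cf.
have [b b01 fb] := EVT_min ler01 cf.
exists (`|f a| + `|f b|) => x x01; have := fa x x01; have := fb x x01.
have := ler_norm (f a); have := ler_norm (- f b); rewrite normrN.
have := normr_ge0 (f a); have := normr_ge0 (f b).
move=> *; rewrite ler_norml; apply/andP; split; lra.
Qed.

Lemma bm_integrable f u v : bm f -> 0 <= u -> v <= 1 ->
  mu.-integrable `[u, v] (EFin \o f).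
Proof.
move=> [mf [M fM]] u0 v1.
have sub : `[u, v] `<=` `[0 : R, 1].
  by apply: subset_itv; rewrite bnd_simp.
apply: measurable_bounded_integrable => //.
- by rewrite /= lebesgue_measure_itv/=; case: ifP => // _; rewrite ltry.
- exact: measurable_funS mf.
- exists M; split; first exact: num_real.
  move=> N MN x /sub x01 /=; exact: le_trans (fM x x01) (ltW MN).
Qed.

(** The integral is unoriented: it is [0] when [v < u], so the order of the endpoints is carried as
    a hypothesis. *)
Definition Iuv f u v : R := \int[mu]_(z in `[u, v]) f z.

Lemma Iuv_cst k u v : u <= v -> Iuv (fun=> k) u v = k * (v - u).
Proof.
move=> uv; rewrite /Iuv Rintegral_cst//= lebesgue_measure_itv/= lte_fin.
case: ltP => //= vu; have -> : u = v by (apply/le_anti; rewrite uv).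
by rewrite subrr.
Qed.

Lemma Iuv_refl f u : Iuv f u u = 0.
Proof. by rewrite /Iuv set_itv1 Rintegral_set1. Qed.

Lemma eq_Iuv f g u v : (forall z, u <= z <= v -> f z = g z) ->
  Iuv f u v = Iuv g u v.
Proof. by move=> fg; apply: eq_Rintegral => z; rewrite inE/= in_itv => /fg. Qed.

Section sub01.
Variables (u v : R).
Hypotheses (u0 : 0 <= u) (v1 : v <= 1).

Lemma IuvD f g : bm f -> bm g ->
  Iuv (fun x => f x + g x) u v = Iuv f u v + Iuv g u v.
Proof. by move=> bf bg; rewrite /Iuv RintegralD//; apply: bm_integrable. Qed.

Lemma IuvB f g : bm f -> bm g ->
  Iuv (fun x => f x - g x) u v = Iuv f u v - Iuv g u v.
Proof. by move=> bf bg; rewrite /Iuv RintegralB//; apply: bm_integrable. Qed.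

Lemma IuvZ k f : bm f -> Iuv (fun x => k * f x) u v = k * Iuv f u v.
Proof. by move=> bf; rewrite /Iuv RintegralZl//; apply: bm_integrable. Qed.

Lemma le_Iuv f g : bm f -> bm g -> (forall z, u <= z <= v -> f z <= g z) ->
  Iuv f u v <= Iuv g u v.
Proof.
move=> bf bg fg; rewrite /Iuv le_Rintegral//; exact: bm_integrable.
Qed.

Lemma Iuv_ge0 f : (forall z, u <= z <= v -> 0 <= f z) -> 0 <= Iuv f u v.
Proof. by move=> f0; apply: Rintegral_ge0 => z /=; rewrite in_itv; exact: f0. Qed.

Lemma Iuv_split f w : bm f -> u <= w <= v ->
  Iuv f u v = Iuv f u w + Iuv f w v.
Proof.
move=> bf /andP[uw wv].
have := @Rintegral_itvB R f (BLeft u) (BRight v) w (bm_integrable _ u v bf u0 v1).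
rewrite !bnd_simp => /(_ uw wv).
rewrite Rintegral_itv_obnd_cbnd; first by rewrite /Iuv => <-; rewrite addrC subrK.
apply: integrableS (bm_integrable _ w v bf _ v1) => //.
  by apply: subset_itv; rewrite bnd_simp.
exact: le_trans uw.
Qed.

End sub01.

Definition prim f y : R := Iuv f 0 y.

Lemma primB f u v : bm f -> 0 <= u -> u <= v -> v <= 1 ->
  prim f v - prim f u = Iuv f u v.
Proof.
move=> bf u0 uv v1; rewrite /prim (@Iuv_split 0 v _ v1 f u)//; last by rewrite u0.
by rewrite addrC addKr.
Qed.

Lemma bm_prim f : bm f -> bm (prim f).
Proof.
move=> bf; apply: bm_continuous.
by apply: (parameterized_integral_continuous ler01); exact: bm_integrable.
Qed.

(** The centre [p] is free so that expansions around the current state can be integrated on either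
    side of it. *)
Lemma Iuv_poly (a b d p : R) u v : u <= v ->
  Iuv (fun z => a + b * (z - p) + d * (z - p) ^+ 2) u v =
  a * (v - u) + b * ((v - p) ^+ 2 - (u - p) ^+ 2) / 2
    + d * ((v - p) ^+ 3 - (u - p) ^+ 3) / 3.
Proof.
rewrite le_eqVlt => /predU1P[->|uv].
  by rewrite Iuv_refl !subrr !mulr0 !mul0r !addr0.
pose F z := a * (z - p) + b / 2 * (z - p) ^+ 2 + d / 3 * (z - p) ^+ 3 : R^o.
pose f z := a + b * (z - p) + d * (z - p) ^+ 2 : R^o.
have dF (x : R) : is_derive x (1 : R) F (f x).
  apply: is_derive_eq.
  by rewrite /f /GRing.scale/=; field.
have cf : continuous f.
  by move=> ?; apply/differentiable_continuous/derivable1_diffP/ex_derive.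
have cF : continuous F.
  by move=> ?; apply/differentiable_continuous/derivable1_diffP/ex_derive.
rewrite /Iuv /Rintegral; have -> := @continuous_FTC2 _ f F u v uv.
- by rewrite /F/=; field.
- exact: continuous_subspaceT.
- split.
  + by move=> ? _; exact: ex_derive.
  + by apply: cvg_at_right_filter; exact: cF.
  + by apply: cvg_at_left_filter; exact: cF.
- by move=> ? _; rewrite derive1E derive_val.
Qed.

End interval_integrals.

(** * Uniform first order Taylor expansion up to the boundary *)

Section C1_taylor.
Context {R : realType}.
Implicit Types (f df : R -> R) (x y eps delta : R).

Lemma continuous01P f : {within `[0 : R, 1], continuous f} <->
  forall x, x \in `[0 : R, 1] -> forall eps, 0 < eps ->
    exists2 delta, 0 < delta & forall y, y \in `[0 : R, 1] -> `|y - x| < delta ->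
      `|f y - f x| < eps.
Proof.
rewrite subspace_continuousP; split=> cf x x01.
  move=> eps e0; have /cvgrPdist_lt/(_ _ e0) := cf _ x01.
  rewrite near_withinE => /nbhs_ballP[delta /= d0 fd]; exists delta => // y y01 yx.
  by rewrite distrC; apply: fd => //=; rewrite /ball/= distrC.
apply/cvgrPdist_lt => eps e0; have [delta d0 fd] := cf x x01 _ e0.
rewrite near_withinE; apply/nbhs_ballP; exists delta => //= y; rewrite /ball/= => yx y01.
by rewrite distrC; apply: fd => //; rewrite distrC.
Qed.

Lemma uniform_continuous01 f : {within `[0 : R, 1], continuous f} ->
  forall eps, 0 < eps -> exists2 delta, 0 < delta &
    forall x y, x \in `[0 : R, 1] -> y \in `[0 : R, 1] -> `|y - x| <= delta ->
      `|f y - f x| <= eps.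
Proof.
move=> /continuous01P cf eps e0.
have /compact_near_coveringP : compact `[0 : R, 1] by exact: segment_compact.
pose P delta x := forall y, y \in `[0 : R, 1] -> `|y - x| <= delta ->
  x \in `[0 : R, 1] -> `|f y - f x| <= eps.
(* Near-covering compactness with radii tending to [0] from the right: near each point, half of its
   continuity radius serves all nearby centres at once. *)
move=> /(_ R 0^'+ P _)[].
  move=> x x01; have [|d d0 fd] := cf x x01 (eps / 2); first by rewrite divr_gt0.
  have d20 : 0 < d / 2 by rewrite divr_gt0.
  exists (ball x (d / 2), [set e | e < d / 2]); first split => /=.
  - exact: nbhsx_ballx.
  - exact: nbhs_right_lt.
  move=> [z e] /= [zx ed] y y01 yz z01; rewrite /ball/= in zx.
  have fz : `|f z - f x| < eps / 2 by apply: fd => //; rewrite distrC; lra.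
  have fy : `|f y - f x| < eps / 2.
    apply: fd => //; rewrite (_ : y - x = (y - z) - (x - z)); last by ring.
    by apply: le_lt_trans (ler_normB _ _) _; lra.
  rewrite (_ : f y - f z = (f y - f x) - (f z - f x)); last by ring.
  by apply: le_trans (ler_normB _ _) _; lra.
move=> delta /= d0 Pd.
exists (delta / 2); first by rewrite divr_gt0.
move=> x y x01 y01 yx; apply: (Pd (delta / 2)) => //=.
  by rewrite sub0r normrN gtr0_norm; lra.
lra.
Qed.

(** By the mean value theorem the increment is [y - x] times [df] at an intermediate point; uniform
    continuity of [df] then makes the remainder uniform in [x], endpoints included. *)
Lemma C1_01_taylor f : C1_01 f -> {within `[0 : R, 1], continuous f} /\
  exists2 df : R -> R, {within `[0 : R, 1], continuous df} &
    forall eps, 0 < eps -> exists2 delta, 0 < delta &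
    forall x y, x \in `[0 : R, 1] -> y \in `[0 : R, 1] -> `|y - x| <= delta ->
      `|f y - f x - df x * (y - x)| <= eps * `|y - x|.
Proof.
move=> [df [cdf dfE]].
have slope x eps : x \in `[0 : R, 1] -> 0 < eps ->
    exists2 delta, 0 < delta & forall y, y \in `[0 : R, 1] -> y != x ->
      `|y - x| < delta -> `|(f y - f x) / (y - x) - df x| < eps.
  move=> x01 e0; have /cvgrPdist_lt/(_ _ e0) := dfE _ x01.
  rewrite near_withinE near_withinE => /nbhs_ballP[delta /= d0 fd]; exists delta => //.
  by move=> y y01 yx dyx; rewrite distrC; apply: fd => //; rewrite /ball/= distrC.
have cf : {within `[0 : R, 1], continuous f}.
  apply/continuous01P => x x01 eps e0; have [d d0 fd] := slope x 1 x01 ltr01.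
  have K0 : 0 < `|df x| + 1 by rewrite ltr_wpDl.
  (* Within [d] the difference quotient is at most [|df x| + 1] in absolute value. *)
  exists (Num.min d (eps / (`|df x| + 1))).
    by rewrite lt_min d0 divr_gt0.
  move=> y y01; rewrite lt_min => /andP[yd ye].
  have [->|yx] := eqVneq y x; first by rewrite subrr normr0.
  have -> : f y - f x = (f y - f x) / (y - x) * (y - x).
    by rewrite divfK// subr_eq0.
  rewrite normrM; move: ye; rewrite ltr_pdivlMr// mulrC; apply: le_lt_trans.
  rewrite ler_wpM2r// -lerBlDl; apply: le_trans (lerB_dist _ _) _.
  by apply: ltW; exact: fd.
split => //; exists df => // eps e0.
(* In the open interval the restricted slopes give ordinary derivatives; with continuity on the
   closed interval this is what the mean value theorem asks for. *)
have dfd x : x \in `]0 : R, 1[ -> is_derive x (1 : R) f (df x).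
  rewrite in_itv/= => /andP[x0 x1].
  have x01 : x \in `[0 : R, 1] by rewrite in_itv/= !ltW.
  suff h : h^-1 *: ((f \o shift x) (h *: (1 : R)) - f x) @[h --> 0^'] --> df x.
    by apply: DeriveDef; [apply/cvg_ex; exists (df x) | exact: cvg_lim].
  apply/cvgrPdist_lt => e e_gt0; have [d d0 fd] := slope x e x01 e_gt0.
  rewrite near_withinE; apply/nbhs_ballP.
  exists (Num.min d (Num.min x (1 - x))); first by rewrite /= !lt_min d0 x0 subr_gt0.
  move=> h /=; rewrite /ball/= sub0r normrN !lt_min => /and3P[hd hx h1] h0.
  have := fd (h + x); rewrite addrK distrC /= scaler1 /GRing.scale/= mulrC; apply => //.
    rewrite in_itv/=; have := ler_norm h; have := ler_norm (- h); rewrite normrN.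
    by move=> *; apply/andP; split; lra.
  by rewrite -subr_eq0 addrK.
have [delta d0 ud] := @uniform_continuous01 df cdf _ e0.
exists delta => // x y.
have sub (u v : R) : 0 <= u -> v <= 1 -> {within `[u, v], continuous f}.
  by move=> u0 v1; apply: continuous_subspaceW cf; apply: subset_itv; rewrite bnd_simp.
rewrite !in_itv/= => /andP[x0 x1] /andP[y0 y1] yxd.
have [xy|yx|->] := ltgtP x y; last by rewrite !subrr mulr0 subr0 !normr0 mulr0.
- have dxy z : z \in `]x, y[ -> is_derive z (1 : R) f (df z).
    rewrite in_itv/= => /andP[xz zy]; apply: dfd; rewrite in_itv/=.
    by rewrite (le_lt_trans x0 xz) (lt_le_trans zy y1).
  have [c] := MVT xy dxy (sub x y x0 y1).
  rewrite in_itv/= => /andP[xc cy] ->.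
  rewrite -mulrBl normrM ler_wpM2r// ud ?in_itv/= ?x0 ?x1//.
    by rewrite (le_trans x0 (ltW xc)) (le_trans (ltW cy) y1).
  by move: yxd; rewrite !gtr0_norm ?subr_gt0//; lra.
- have dyx z : z \in `]y, x[ -> is_derive z (1 : R) f (df z).
    rewrite in_itv/= => /andP[yz zx]; apply: dfd; rewrite in_itv/=.
    by rewrite (le_lt_trans y0 yz) (lt_le_trans zx x1).
  have [c] := MVT yx dyx (sub y x y0 x1).
  rewrite in_itv/= => /andP[yc cx] fxy.
  have -> : f y - f x = df c * (y - x) by rewrite -opprB fxy -mulrN opprB.
  rewrite -mulrBl normrM ler_wpM2r// ud ?in_itv/= ?x0 ?x1//.
    by rewrite (le_trans y0 (ltW yc)) (le_trans (ltW cx) x1).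
  by move: yxd; rewrite !ltr0_norm ?subr_lt0//; lra.
Qed.

End C1_taylor.

(** * Expected hitting times from a Lyapunov function *)

Section expected_hitting_time.
Context {R : realType} {d : measure_display} {Omega : measurableType d}.
Context {P : probability Omega R} (X : nat -> {RV P >-> R}) (A : set R).
Local Open Scope ereal_scope.

(** The event [tau(A) > n], time [n] included among the avoided times. *)
Definition unhit (n : nat) : set Omega :=
  \bigcap_(k in [set k | (k <= n)%N]) ~` (X k @^-1` A).

Lemma unhitS n : unhit n.+1 = unhit n `&` ~` (X n.+1 @^-1` A).
Proof.
apply/seteqP; split=> w.
  by move=> wH; split=> [k /= kn|]; apply: wH => //=; exact: leqW.
move=> [wH wS] k /=; rewrite leq_eqVlt => /predU1P[->//|]; rewrite ltnS.
exact: wH.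
Qed.

Lemma unhit_past n : measurable A -> past X n (unhit n).
Proof.
move=> mA; rewrite /past; set G := (X in <<s X >>).
change (measurable (unhit n : set (g_sigma_algebraType G))).
apply: bigcap_measurableType => k kn; apply: measurableC.
by apply: sub_sigma_algebra; exists k => //; exists A => //; rewrite setTI.
Qed.

Lemma measurable_unhit n : measurable A -> measurable (unhit n).
Proof.
move=> mA; apply: bigcap_measurableType => k kn; apply: measurableC.
exact: measurable_funPTI.
Qed.

Lemma unhit_sum m w : (forall k, (k < m)%N -> ~ A (X k w)) ->
  \sum_(0 <= n < m) (\1_(unhit n) w)%:E = m%:R%:E :> \bar R.
Proof.
elim: m => [|m IH] Am; first by rewrite big_nil.
rewrite big_nat_recr//= IH => [|k km]; last exact: Am (ltnW km).
by rewrite indicE mem_set// -EFinD natr1.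
Qed.

(** An integer time is the sum over [n] of the indicators of [tau > n]; if [A] is never visited
    every term is [1] and both sides are infinite. *)
Lemma hitting_timeE w :
  hitting_time X A w = \sum_(0 <= n <oo) (\1_(unhit n) w)%:E.
Proof.
have ge0 n : 0 <= (\1_(unhit n) w)%:E :> \bar R by rewrite lee_fin.
rewrite /hitting_time.
have [[t At]|noA] := pselect (exists t, A (X t w)); last first.
  rewrite (_ : [set t | _] = set0); last first.
    by apply/seteqP; split=> // t At; apply: noA; exists t.
  rewrite image_set0 ereal_inf0; apply/esym/eq_infty => r.
  pose m := (Num.trunc `|r|).+1.
  apply: (@le_trans _ _ (\sum_(0 <= n < m) (\1_(unhit n) w)%:E)); last first.
    exact: nneseries_lim_ge.
  rewrite unhit_sum => [|k _ Ak]; last by apply: noA; exists k.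
  by rewrite lee_fin (le_trans (ler_norm r))// ltW// truncnS_gt.
have exA : exists t, `[< A (X t w) >] by exists t; exact/asboolP.
case: (ex_minnP exA) => {t At exA} t /asboolP At tmin.
have nA k : (k < t)%N -> ~ A (X k w).
  by move=> kt Ak; move: kt; rewrite ltnNge tmin//; exact/asboolP.
have -> : \sum_(0 <= n <oo) (\1_(unhit n) w)%:E = t%:R%:E :> \bar R.
  rewrite (nneseries_split 0 t)// add0n unhit_sum// eseries0 ?adde0// => k tk _.
  by rewrite indicE memNset// => /(_ t tk).
apply/eqP; rewrite eq_le; apply/andP; split.
  by apply: ereal_inf_lbound; exists t.
apply: le_ereal_inf_tmp => _ [s /= As <-].
by rewrite lee_fin ler_nat tmin//; exact/asboolP.
Qed.

(* The Lyapunov function is [\sum_j \1_(B j)], with values in [[0, N]]. *)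
Lemma expected_hitting_time_le (g : R -> set R -> \bar R) (x : R) (N : nat)
    (B : nat -> set R) :
  markov_chain g x X -> measurable A -> (forall j, measurable (B j)) ->
  (forall j, B j `<=` `[0%R, 1%R] `\` A) ->
  (forall j, measurable_fun `[0%R : R, 1%R] (g ^~ (B j))) ->
  (forall j y, y \in `[0%R, 1%R] -> 0 <= g y (B j)) ->
  (forall y, y \in `[0%R, 1%R] -> ~ A y ->
    \sum_(0 <= j < N) g y (B j) + 1 <= \sum_(0 <= j < N) (\1_(B j) y)%:E) ->
  \int[P]_w hitting_time X A w <= N%:R%:E.
Proof.
move=> [X01 _ XM] mA mB BA mg g0 drift.
have mXB n (C : set R) : measurable C -> measurable (X n @^-1` C).
  by move=> mC; exact: measurable_funPTI.
(* [V n] is the expectation of the Lyapunov function at [X n], restricted to the event that [A] is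
   unhit up to time [n]. *)
pose V n : \bar R := \sum_(0 <= j < N) P (unhit n `&` X n @^-1` B j).
have mgX n j : measurable_fun setT (fun w => g (X n w) (B j)).
  apply: (@measurable_comp _ _ _ _ _ _ `[0%R : R, 1%R] (g ^~ (B j))) => //.
  by move=> _ [w _ <-] /=; rewrite X01.
(* The Markov property is applied on [unhit n]; avoidance of [A] at time [n.+1] is automatic inside
   [B j], which misses [A]. *)
have step n : V n.+1 + P (unhit n) <= V n.
  have mH := measurable_unhit n mA.
  have -> : V n.+1 = \sum_(0 <= j < N) \int[P]_(w in unhit n) g (X n w) (B j).
    apply: eq_bigr => j _; rewrite -XM//; last 2 first.
      exact: unhit_past.
      by move=> y /BA[].
    congr (P _); rewrite unhitS; apply/seteqP; split=> w [].
      by move=> [].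
    by move=> Hw Bw; split => //; split => //= Aw; have [] := BA _ _ Bw.
  have -> : P (unhit n) = \int[P]_(w in unhit n) 1.
    by rewrite integral_cst// mul1e.
  rewrite -ge0_integral_sum//; last 2 first.
    by move=> j; exact: measurable_funTS.
    by move=> j w _; rewrite g0.
  rewrite -ge0_integralD//; last 2 first.
    by move=> w _; apply: sume_ge0 => j _; rewrite g0.
    by apply: emeasurable_sum => j; exact: measurable_funTS.
  have -> : V n = \int[P]_(w in unhit n) \sum_(0 <= j < N) (\1_(B j) (X n w))%:E.
    rewrite ge0_integral_sum//; last first.
      move=> j; apply/measurable_EFinP; apply: measurable_funTS.
      exact: (measurableT_comp (measurable_indic _)).
    apply: eq_bigr => j _; rewrite setIC.
    rewrite -(integral_indic P mH); last exact: mXB.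
    by [].
  apply: ge0_le_integral => //.
  - by move=> w _; rewrite adde_ge0// sume_ge0// => j _; rewrite g0.
  - apply: emeasurable_funD => //.
    by apply: emeasurable_sum => j; exact: measurable_funTS.
  - apply: emeasurable_sum => j; apply/measurable_EFinP; apply: measurable_funTS.
    exact: (measurableT_comp (measurable_indic _)).
  - by move=> w Hw; apply: drift => //; exact: Hw (leqnn n).
(* As [0 <= V m] and [V 0 <= N], telescoping bounds every partial sum of [P (unhit n)] by [N]. *)
have tele m : \sum_(0 <= n < m) P (unhit n) + V m <= V 0%N.
  elim: m => [|m IH]; first by rewrite big_nil add0e.
  rewrite big_nat_recr//= -addeA; apply: le_trans IH.
  by rewrite leeD2l// addeC.
have V0 n : 0 <= V n by apply: sume_ge0.
have V0N : V 0%N <= N%:R%:E.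
  rewrite /V; elim: (N) => [|M IH]; first by rewrite big_nil.
  rewrite big_nat_recr//= -natr1 EFinD leeD// probability_le1//.
  by apply: measurableI; [exact: measurable_unhit|exact: mXB].
under eq_integral do rewrite hitting_timeE.
rewrite integral_nneseries//; last first.
  move=> n; apply/measurable_EFinP; apply: measurable_indic.
  exact: measurable_unhit.
rewrite (eq_eseriesr (g := fun n => P (unhit n))); last first.
  by move=> n _; rewrite integral_indic// ?setIT//; exact: measurable_unhit.
apply: lime_le; first by apply: is_cvg_nneseries => n _ _; exact: measure_ge0.
apply: nearW => m; apply: le_trans (le_trans (tele m) V0N).
by rewrite leeDl.
Qed.

End expected_hitting_time.

(** * Scalar estimates for the second order expansion *)

Section local_expansion.
Context {R : realFieldType}.
Implicit Types (M B c theta eta g b t s u e L : R).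

Lemma normM_le (x y X Y : R) : `|x| <= X -> `|y| <= Y -> `|x * y| <= X * Y.
Proof. by move=> xX yY; rewrite normrM ler_pM. Qed.

(* [theta <= 1 / (100 M)] makes [M theta] negligible against the numerical
   gaps below; [M] and [B] bound [g] and the logarithmic derivative [b]. *)
Record small_scale M B c theta : Prop := SmallScale {
  scale_M : 1 <= M;
  scale_B : 0 <= B;
  scale_c : 0 < c <= 1;
  scale_theta : 0 < theta;
  scale_Mtheta : M * theta <= 100^-1;
  scale_Bc : (B + 1) ^+ 2 * c <= theta }.

Lemma small_scale_theta M B c theta : small_scale M B c theta -> theta <= 100^-1.
Proof. by case=> M1 _ _ t0 Mt _; nra. Qed.

Lemma small_scale_bounds M B c theta : small_scale M B c theta ->
  B * c <= theta /\ B ^+ 2 * c <= theta.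
Proof.
case=> _ B0 /andP[c0 _] _ _.
have -> : (B + 1) ^+ 2 * c = B ^+ 2 * c + 2 * (B * c) + c by ring.
have Bc : 0 <= B * c by rewrite mulr_ge0// ltW.
have BBc : 0 <= B ^+ 2 * c by rewrite mulr_ge0// ?sqr_ge0// ltW.
by split; lra.
Qed.

Arguments small_scale_theta {M B c theta}.
Arguments small_scale_bounds {M B c theta}.
Arguments normM_le {x y X Y}.

Section scale.
Variables (M B c theta : R).
Hypothesis sc : small_scale M B c theta.

(** Here and below [u] stands for a density ratio [psi z / psi x], and [t] or [s] for the distance
    to [x]. The linear part and the remainder are each at most [theta]. *)
Lemma near_one b t u : `|b| <= B -> 0 <= t <= c -> `|u - 1 - b * t| <= theta * t ->
  `|u - 1| <= 2 * theta.
Proof.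
move=> bB /andP[t0 tc] ue.
have [Bc _] := small_scale_bounds sc; have [_ B0 /andP[c0 c1] th0 _ _] := sc.
have bt : `|b * t| <= B * c by apply: normM_le => //; rewrite ger0_norm.
have -> : u - 1 = (u - 1 - b * t) + b * t by ring.
by apply: le_trans (ler_normD _ _) _; nra.
Qed.

(** Dividing by [u] amounts to multiplying by [1 - b * t], up to an error of order [theta * t].
    Times [g] this is at most [3 / 100 * t], because [M * theta] is small; the slack in [4 / 5] and
    [3 / 2] absorbs all errors. *)
Lemma quotient_lower g b t u e N : `|g| <= M -> `|b| <= B -> 0 <= t <= c ->
  `|u - 1 - b * t| <= theta * t -> 0 <= e ->
  g + t * (1 - 2 * theta) - (1 + 2 * theta) * e <= N ->
  g * (1 - b * t) + 4 / 5 * t - 3 / 2 * e <= N / u.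
Proof.
move=> gM bB tc ue e0 gN.
have := near_one _ _ _ bB tc ue; rewrite ler_norml => /andP[u1 u2].
have th := small_scale_theta sc.
have [Bc BBc] := small_scale_bounds sc; have [M1 B0 /andP[c0 c1] th0 Mth _] := sc.
have u0 : 0 < u by lra.
rewrite ler_pdivlMr//; apply: le_trans gN.
case/andP: tc => t0 tc.
have bt : `|b * t| <= B * c by apply: normM_le => //; rewrite ger0_norm.
pose d := u * (1 - b * t) - 1.
have dE : d = (u - 1 - b * t) * (1 - b * t) - b * (b * t) * t by rewrite /d; ring.
have d_le : `|d| <= 3 * theta * t.
  rewrite dE; apply: le_trans (ler_normB _ _) _.
  have h1 : `|(u - 1 - b * t) * (1 - b * t)| <= theta * t * (1 + theta).
    apply: normM_le => //; apply: le_trans (ler_normB _ _) _.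
    by rewrite normr1 lerD2l (le_trans bt).
  have h2 : `|b * (b * t) * t| <= theta * t.
    rewrite [leLHS]normrM (ger0_norm t0) ler_wpM2r// (le_trans _ BBc)//.
    by rewrite expr2 -mulrA; apply: normM_le.
  have : theta * t * theta <= theta * t by rewrite ler_piMr ?mulr_ge0//; lra.
  lra.
have gd : `|g * d| <= 3 / 100 * t.
  apply: le_trans (normM_le gM d_le) _.
  have : M * theta * t <= 100^-1 * t by rewrite ler_wpM2r.
  lra.
have gdE : (g * (1 - b * t) + 4 / 5 * t - 3 / 2 * e) * u =
  g + g * d + 4 / 5 * (u * t) - 3 / 2 * (u * e) by rewrite /d; ring.
rewrite gdE.
have ut : u * t <= (1 + 2 / 100) * t by rewrite ler_wpM2r//; lra.
have ue' : (1 - 2 / 100) * e <= u * e by rewrite ler_wpM2r//; lra.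
have tt : theta * t <= 100^-1 * t by rewrite ler_wpM2r.
have te : theta * e <= 100^-1 * e by rewrite ler_wpM2r.
move: gd; rewrite ler_norml => /andP[_ gd]; lra.
Qed.

(** For [b >= 0] the acceptance is about [1]; for [b < 0] it is about [1 + b * s], which flips the
    sign of [- b * s^2 / 2]. Either way this term becomes [- |b| * s^2 / 2], so the part carrying
    [g] changes sign when [g] and [b] are both negated. *)
Lemma accepted_lower g b s u e G : `|g| <= M -> `|b| <= B -> 0 <= s <= c ->
  `|u - 1 - b * s| <= theta * s -> 0 <= e ->
  (g - 3 / 2 * e) * s + (4 / 5 - g * b) * s ^+ 2 / 2 <= G ->
  g * (s - `|b| * s ^+ 2 / 2) + s ^+ 2 / 4 - 2 * c * e <= Num.min 1 u * G.
Proof.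
move=> gM bB sc0 us e0 sG.
have := near_one _ _ _ bB sc0 us; rewrite ler_norml => /andP[u1 u2].
have th := small_scale_theta sc.
have [Bc BBc] := small_scale_bounds sc; have [M1 B0 /andP[c0 c1] th0 Mth _] := sc.
case/andP: sc0 => s0 sc0.
have u0 : 0 < u by lra.
set a := Num.min 1 u.
have a0 : 0 <= a by rewrite /a le_min ler01 ltW.
have a1 : a <= 1 by rewrite /a ge_min lexx.
have al : 1 - 2 / 100 <= a by rewrite /a le_min; apply/andP; split; lra.
apply: (@le_trans _ _ (a * ((g - 3 / 2 * e) * s + (4 / 5 - g * b) * s ^+ 2 / 2)));
  last by rewrite ler_wpM2l.
have s2 : 0 <= s ^+ 2 by rewrite sqr_ge0.
pose d := a * (s - b * s ^+ 2 / 2) - (s - `|b| * s ^+ 2 / 2).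
have d_le : `|d| <= 4 * theta * s ^+ 2.
  pose m := u - 1 - b * s.
  have m_le : `|m| <= theta * s by [].
  have mm := m_le; move: mm; rewrite ler_norml => /andP[m1 m2].
  have bs : `|b * s| <= theta.
    by apply: le_trans Bc; apply: normM_le => //; rewrite ger0_norm.
  have bbs : `|b * (b * s) * s ^+ 2| <= theta * s ^+ 2.
    rewrite [leLHS]normrM (ger0_norm s2) ler_wpM2r// (le_trans _ BBc)//.
    by rewrite expr2 -mulrA; apply: normM_le => //; apply: normM_le => //; rewrite ger0_norm.
  have mbs : `|m * s * (b * s)| <= theta * s ^+ 2 * theta.
    apply: normM_le => //; rewrite expr2 mulrA; apply: normM_le => //.
    by rewrite ger0_norm.
  have tts : theta * s ^+ 2 * theta <= theta * s ^+ 2.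
    by rewrite ler_piMr ?mulr_ge0//; lra.
  have ms : `|m * s| <= theta * s ^+ 2.
    by rewrite expr2 mulrA; apply: normM_le => //; rewrite ger0_norm.
  have bds : `|b| * s <= theta by rewrite -(ger0_norm s0) -normrM.
  move: bbs mbs ms; rewrite !ler_norml => /andP[x1 x2] /andP[y1 y2] /andP[z1 z2].
  (* When [1 <= u] the slope [b] may still be negative, but then the expansion of [u] forces
     [|b| * s <= theta * s]; positive [b] with [u < 1] is treated likewise. *)
  have [su|us1] := leP 1 u.
    have aE : a = 1 by rewrite /a min_l.
    rewrite /d aE mul1r.
    have -> : s - b * s ^+ 2 / 2 - (s - `|b| * s ^+ 2 / 2) = (`|b| - b) * s * s / 2.
      by ring.
    have : 0 <= (`|b| - b) * s <= 2 * theta * s.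
      have [b0|b0] := leP 0 b; first by rewrite ger0_norm// subrr mul0r lexx/= !mulr_ge0// ltW.
      by rewrite ltr0_norm//; rewrite /m in m1 m2; apply/andP; split; nra.
    move=> /andP[k1 k2].
    have k3 : 0 <= (`|b| - b) * s * s by rewrite mulr_ge0.
    have k4 : (`|b| - b) * s * s <= 2 * theta * s * s by rewrite ler_wpM2r.
    rewrite expr2; lra.
  have aE : a = 1 + b * s + m by rewrite /a min_r ?ltW// /m; ring.
  have -> : d = (`|b| + b) * s * s / 2 + m * s - b * (b * s) * s ^+ 2 / 2
                - m * s * (b * s) / 2 by rewrite /d aE; field.
  have : 0 <= (`|b| + b) * s <= 2 * theta * s.
    have [b0|b0] := leP b 0; first by rewrite ler0_norm// addrC subrr mul0r lexx/= !mulr_ge0// ltW.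
    by rewrite gtr0_norm//; rewrite /m in m1 m2; apply/andP; split; nra.
  move=> /andP[k1 k2].
  have k3 : 0 <= (`|b| + b) * s * s by rewrite mulr_ge0.
  have k4 : (`|b| + b) * s * s <= 2 * theta * s * s by rewrite ler_wpM2r.
  have k5 : 2 * theta * s * s = 2 * (theta * s ^+ 2) by ring.
  by apply/andP; split; lra.
have gd : `|g * d| <= 4 / 100 * s ^+ 2.
  apply: le_trans (normM_le gM d_le) _.
  have : M * theta * s ^+ 2 <= 100^-1 * s ^+ 2 by rewrite ler_wpM2r.
  lra.
have -> : a * ((g - 3 / 2 * e) * s + (4 / 5 - g * b) * s ^+ 2 / 2) =
   g * (s - `|b| * s ^+ 2 / 2) + g * d - 3 / 2 * (a * (e * s)) + 2 / 5 * (a * s ^+ 2).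
  by rewrite /d; field.
have as2 : (1 - 2 / 100) * s ^+ 2 <= a * s ^+ 2 by rewrite ler_wpM2r.
have es : e * s <= e * c by rewrite ler_wpM2l.
have es0 : 0 <= e * s by rewrite mulr_ge0.
have aes : a * (e * s) <= e * s by rewrite ler_piMl.
move: gd; rewrite ler_norml => /andP[gd _]; lra.
Qed.

(* [l] and [e] are the distances from [x] to the ends of the proposal window;
   the window is symmetric unless [x] is within [c] of an endpoint of [0,1]. *)
Lemma window_moment g b l e L : `|b| <= B -> 0 <= L -> 0 <= l <= c -> 0 <= e <= c ->
  [\/ l = c /\ e = c, e = c /\ - (2 * L) <= g | l = c /\ g <= 2 * L] ->
  c ^+ 3 / 12 - 5 * c ^+ 2 * L <=
  (g * (e ^+ 2 / 2 - `|b| * e ^+ 3 / 6) + e ^+ 3 / 12 - 2 * c * L * e) +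
  (- g * (l ^+ 2 / 2 - `|b| * l ^+ 3 / 6) + l ^+ 3 / 12 - 2 * c * L * l).
Proof.
move=> bB L0 /andP[l0 lc] /andP[e0 ec].
have th := small_scale_theta sc.
have [Bc _] := small_scale_bounds sc; have [M1 B0 /andP[c0 c1] th0 Mth _] := sc.
have bc : `|b| * c <= 1.
  by apply: (le_trans (ler_wpM2r (ltW c0) bB)); lra.
(* [k^2 / 2 - |b| * k^3 / 6] integrates [s - |b| * s^2 / 2] over [[0, k]]. Cutting one side of the
   window leaves [g] times a difference in [[0, c^2 / 2]], so the one-sided bound on [g] costs at
   most [c^2 * L]; the terms in [2 * c * L] cost at most [4 * c^2 * L] more. *)
have key (k : R) : 0 <= k <= c ->
    0 <= (c ^+ 2 / 2 - `|b| * c ^+ 3 / 6) - (k ^+ 2 / 2 - `|b| * k ^+ 3 / 6) <= c ^+ 2 / 2.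
  move=> /andP[k0 kc].
  have -> : (c ^+ 2 / 2 - `|b| * c ^+ 3 / 6) - (k ^+ 2 / 2 - `|b| * k ^+ 3 / 6) =
     (c - k) * ((c + k) / 2 - `|b| * (c ^+ 2 + c * k + k ^+ 2) / 6) by field.
  have b0 : 0 <= `|b| by [].
  have h1 : `|b| * (c ^+ 2 + c * k + k ^+ 2) <= 2 * (c + k).
    apply: (@le_trans _ _ (`|b| * (2 * c * (c + k)))); first by rewrite ler_wpM2l//; nra.
    by rewrite (_ : _ * (_ * _) = `|b| * c * (2 * (c + k))); [rewrite ler_piMl//; lra|ring].
  have h2 : 0 <= `|b| * (c ^+ 2 + c * k + k ^+ 2).
    by rewrite mulr_ge0// !addr_ge0 ?mulr_ge0 ?sqr_ge0//; lra.
  by apply/andP; split; nra.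
have c2 : 0 <= c ^+ 2 by rewrite sqr_ge0.
have cL : 0 <= c * L by rewrite mulr_ge0// ltW.
have l3 := exprn_ge0 3 l0; have e3 := exprn_ge0 3 e0.
have cle : c * L * e <= c * L * c by rewrite ler_wpM2l.
have cll : c * L * l <= c * L * c by rewrite ler_wpM2l.
have ccL : c * L * c = c ^+ 2 * L by ring.
have c2L : 0 <= c ^+ 2 * L by rewrite mulr_ge0.
case=> [[lE eE]|[eE gL]|[lE gL]]; subst.
- lra.
- have lc0 : 0 <= l <= c by rewrite l0.
  have /andP := key l lc0; set J := _ - _ => -[J0 J1].
  have gJ : - (2 * L) * J <= g * J by rewrite ler_wpM2r.
  have LJ : L * J <= L * (c ^+ 2 / 2) by rewrite ler_wpM2l.
  have gJE : g * J = g * (c ^+ 2 / 2 - `|b| * c ^+ 3 / 6) + - g * (l ^+ 2 / 2 - `|b| * l ^+ 3 / 6).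
    by rewrite /J; ring.
  lra.
- have ec0 : 0 <= e <= c by rewrite e0.
  have /andP := key e ec0; set J := _ - _ => -[J0 J1].
  have gJ : g * J <= 2 * L * J by rewrite ler_wpM2r.
  have LJ : L * J <= L * (c ^+ 2 / 2) by rewrite ler_wpM2l.
  have gJE : g * J = - g * (e ^+ 2 / 2 - `|b| * e ^+ 3 / 6) - - g * (c ^+ 2 / 2 - `|b| * c ^+ 3 / 6).
    by rewrite /J; ring.
  lra.
Qed.

End scale.
End local_expansion.

Arguments small_scale_theta {R M B c theta}.
Arguments small_scale_bounds {R M B c theta}.
Arguments near_one {R M B c theta} _ {b t u}.
Arguments quotient_lower {R M B c theta} _ {g b t u e N}.
Arguments accepted_lower {R M B c theta} _ {g b s u e G}.
Arguments window_moment {R M B c theta} _ {g b l e L}.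

(** * The averaged potential of [A] and bounds on its slope *)

Section lyapunov.
Context {R : realType}.
Local Notation bm := bounded_measurable01.
Variables (psi : R -> R) (A : set R) (alpha : R).
Hypotheses (bpsi : bm psi) (bpsiV : bm (fun z => (psi z)^-1)).
Hypothesis psi_gt0 : forall z, 0 <= z <= 1 -> 0 < psi z.
Hypothesis psi_mass : Iuv psi 0 1 = 1.
Hypotheses (mA : measurable A) (alpha_gt0 : 0 < alpha).

Definition target_mass : R := Iuv (fun z => psi z * \1_A z) 0 1.

Hypothesis massA : alpha <= target_mass.

(* Density, with respect to Lebesgue measure, of the signed measure
   [pi - pi (. | A)], whose total mass is zero. *)
Definition excess z : R := psi z - target_mass^-1 * (psi z * \1_A z).

(* [- hit_slope] is the derivative of the diffusive approximation of the
   expected hitting time of [A]. *)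
Definition hit_slope z : R := prim excess z * (psi z)^-1.

Lemma bm_indicA : bm (\1_A : R -> R). Proof. exact: bm_indic. Qed.
Lemma bm_psiA : bm (fun z => psi z * \1_A z).
Proof. exact: bmM bpsi bm_indicA. Qed.
Lemma bm_excess : bm excess.
Proof. by apply: bmB bpsi _; apply: bmM (bm_cst _) bm_psiA. Qed.
Lemma bm_hit_slope : bm hit_slope.
Proof. by apply: bmM bpsiV; apply: bm_prim; exact: bm_excess. Qed.

Lemma target_mass_gt0 : 0 < target_mass. Proof. exact: lt_le_trans massA. Qed.

Lemma IuvE_excess u v : 0 <= u -> v <= 1 ->
  Iuv excess u v = Iuv psi u v - target_mass^-1 * Iuv (fun z => psi z * \1_A z) u v.
Proof.
move=> u0 v1; rewrite -IuvZ// ?IuvB//; first exact: bmM (bm_cst _) bm_psiA.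
exact: bm_psiA.
Qed.

Lemma prim_excess1 : prim excess 1 = 0.
Proof.
by rewrite /prim IuvE_excess// psi_mass mulVf ?subrr// gt_eqF// target_mass_gt0.
Qed.

Lemma indicA_itv z : 0 <= (\1_A z : R) <= 1.
Proof. by rewrite /indic; case: (_ \in _); rewrite /= ?lexx ?ler01. Qed.

Lemma target_mass_le1 : target_mass <= 1.
Proof.
rewrite -psi_mass; apply: le_Iuv => //; first exact: bm_psiA.
move=> z z01; have /andP[A0 A1] := indicA_itv z.
by rewrite ler_piMr// ltW// psi_gt0.
Qed.

(** Since [alpha <= target_mass <= 1], both masses being subtracted lie between [0] and
    [Iuv psi u v / alpha]. *)
Lemma excess_le u v : 0 <= u -> u <= v -> v <= 1 ->
  `|Iuv excess u v| <= Iuv psi u v / alpha.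
Proof.
move=> u0 uv v1; rewrite IuvE_excess//.
set Q := Iuv psi u v; set q := Iuv _ u v.
have z01 z : u <= z <= v -> 0 <= z <= 1.
  by move=> /andP[uz zv]; rewrite (le_trans u0)// (le_trans zv).
have q0 : 0 <= q.
  apply: Iuv_ge0 => z /z01 zz; have /andP[A0 _] := indicA_itv z.
  by rewrite mulr_ge0// ltW// psi_gt0.
have qQ : q <= Q.
  apply: le_Iuv => //; first exact: bm_psiA.
  move=> z /z01 zz; have /andP[_ A1] := indicA_itv z.
  by rewrite ler_piMr// ltW// psi_gt0.
have p0 := target_mass_gt0; have p1 := target_mass_le1.
have Qa : Q <= Q / alpha.
  by rewrite ler_pdivlMr// ler_piMr ?(le_trans q0)// (le_trans massA).
have pq : target_mass^-1 * q <= Q / alpha.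
  by rewrite mulrC ler_pM// ?invr_ge0 ?(ltW p0)// lef_pV2 ?posrE.
have pq0 : 0 <= target_mass^-1 * q by rewrite mulr_ge0// invr_ge0 ltW.
rewrite ler_norml; apply/andP; split; lra.
Qed.

(** The total excess is zero, so its primitive at [x] can be computed from either endpoint; the side
    pointing away from the mode will be the useful one. *)
Lemma prim_excess_le x : 0 <= x <= 1 ->
  `|prim excess x| <= Iuv psi 0 x / alpha /\ `|prim excess x| <= Iuv psi x 1 / alpha.
Proof.
move=> /andP[x0 x1]; split; first exact: excess_le.
rewrite -normrN -[- _]add0r -prim_excess1 primB//; first exact: excess_le.
exact: bm_excess.
Qed.

(** This bound depends on the minimum of [psi] and serves the choice of the threshold. *)
Lemma hit_slope_le_inv m x : 0 < m -> (forall z, 0 <= z <= 1 -> m <= psi z) ->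
  0 <= x <= 1 -> `|hit_slope x| <= (alpha * m)^-1.
Proof.
move=> m0 mpsi x01; have [ex _] := prim_excess_le x x01.
have px := psi_gt0 x x01; have /andP[x0 x1] := x01.
rewrite normrM (gtr0_norm (x := (psi x)^-1)) ?invr_gt0// invfM ler_pM//.
- by rewrite ltW// invr_gt0.
- apply: (le_trans ex); rewrite ler_piMl ?invr_ge0 ?(ltW alpha_gt0)//.
  rewrite -psi_mass (@Iuv_split _ 0 1 _ _ psi x)// lerDl; apply: Iuv_ge0 => z /andP[xz z1].
  by rewrite ltW// psi_gt0// z1 (le_trans x0).
- by rewrite lef_pV2 ?posrE// mpsi.
Qed.

(** On the side of [x] away from the mode, [psi z <= r * rho z <= r * rho x <= r^2 * psi x]. That
    side thus has mass at most [r^2 * psi x], and dividing by [psi x] removes the dependence on the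
    size of [psi]. *)
Lemma hit_slope_le_unimodal r rho x : 1 <= r -> unimodal rho ->
  (forall z, z \in `[0, 1] -> r^-1 <= rho z / psi z <= r) ->
  0 <= x <= 1 -> `|hit_slope x| <= r ^+ 2 / alpha.
Proof.
move=> r1 [m [m01 incr decr]] ratio x01.
have r0 : 0 < r by exact: lt_le_trans r1.
have [ex0 ex1] := prim_excess_le x x01.
have px := psi_gt0 x x01; have /andP[x0 x1] := x01.
have psi_rho z : 0 <= z <= 1 -> psi z <= r * rho z /\ rho z <= r * psi z.
  move=> z01; have pz := psi_gt0 z z01.
  have : z \in `[0, 1] by rewrite in_itv.
  move=> /ratio; rewrite ler_pdivlMr// ler_pdivrMr// => /andP[h1 h2]; split => //.
  by move: h1; rewrite mulrC ler_pdivrMr// mulrC.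
have compare u v : 0 <= u -> u <= v -> v <= 1 ->
    (forall z, u <= z <= v -> rho z <= rho x) -> Iuv psi u v <= r ^+ 2 * psi x.
  move=> u0 uv v1 zx.
  have r2 : 0 <= r ^+ 2 * psi x by rewrite mulr_ge0 ?sqr_ge0// ltW.
  apply: (@le_trans _ _ (Iuv (fun=> r ^+ 2 * psi x) u v)).
    apply: le_Iuv => //; first exact: bm_cst.
    move=> z /[dup] /zx rzx /andP[uz zv].
    have z01 : 0 <= z <= 1 by rewrite (le_trans u0)// (le_trans zv).
    have [h1 _] := psi_rho z z01; have [_ h2] := psi_rho x x01.
    apply: (le_trans h1); rewrite expr2 -mulrA ler_wpM2l// ?(ltW r0)//.
    exact: le_trans h2.
  by rewrite Iuv_cst// ler_piMr//; lra.
rewrite normrM (gtr0_norm (x := (psi x)^-1)) ?invr_gt0// ler_pdivrMr//.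
rewrite mulrAC.
have [xm|mx] := leP x m.
  apply: (le_trans ex0); rewrite ler_wpM2r ?invr_ge0 ?(ltW alpha_gt0)//.
  apply: compare => // z /andP[z0 zx].
  move: zx; rewrite le_eqVlt => /predU1P[->//|zx].
  by apply: ltW; exact: incr.
apply: (le_trans ex1); rewrite ler_wpM2r ?invr_ge0 ?(ltW alpha_gt0)//.
apply: compare => // z /andP[xz z1].
move: xz; rewrite le_eqVlt => /predU1P[->//|xz].
by apply: ltW; apply: decr => //; exact: ltW.
Qed.

Lemma prim_hit_slope_le r0 x : 0 <= x <= 1 ->
  (forall z, 0 <= z <= 1 -> `|hit_slope z| <= r0) -> `|prim hit_slope x| <= r0.
Proof.
move=> /andP[x0 x1] r0P.
have r00 : 0 <= r0 by apply: le_trans (r0P 0 _); rewrite ?lexx ?ler01.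
have up : prim hit_slope x <= Iuv (fun=> r0) 0 x.
  apply: le_Iuv => //; [exact: bm_hit_slope|exact: bm_cst|].
  by move=> z /andP[z0 zx]; apply: le_trans (ler_norm _) (r0P z _); rewrite z0 (le_trans zx).
have dn : Iuv (fun=> - r0) 0 x <= prim hit_slope x.
  apply: le_Iuv => //; [exact: bm_cst|exact: bm_hit_slope|].
  move=> z /andP[z0 zx]; rewrite lerNl; apply: le_trans (r0P z _).
    by rewrite -normrN ler_norm.
  by rewrite z0 (le_trans zx).
move: up dn; rewrite !Iuv_cst// !subr0 mulNr => up dn.
have rx : r0 * x <= r0 by rewrite ler_piMr.
by rewrite ler_norml; apply/andP; split; lra.
Qed.

(** The factor [48 * c^-2] turns the window moment [c^3 / 12] into [4 * c]; [r0], an upper bound for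
    the primitive, keeps the barrier nonnegative. *)
Definition barrier (r0 c y : R) : R := 48 * c ^- 2 * (r0 - prim hit_slope y).

Definition lyapunov (r0 c y : R) : R := (barrier r0 c y + 576 / alpha) * (1 - \1_A y).

Lemma bm_lyapunov r0 c : bm (lyapunov r0 c).
Proof.
apply: bmM; last by apply: bmB bm_indicA; exact: bm_cst.
apply: bmD; last exact: bm_cst.
apply: bmM; first exact: bm_cst.
by apply: bmB; [exact: bm_cst|apply: bm_prim; exact: bm_hit_slope].
Qed.

(** * Drift of the Lyapunov function at one state [x] *)

Section local.
Variables (M B c theta x b : R).
Hypothesis sc : small_scale M B c theta.
Hypotheses (x01 : 0 <= x <= 1) (c_half : c <= 2^-1).
Hypotheses (b_le : `|b| <= B) (slope_le : `|hit_slope x| <= M).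
Hypothesis taylor : forall z, 0 <= z <= 1 -> `|z - x| <= c ->
  `|psi z / psi x - 1 - b * (z - x)| <= theta * `|z - x|.

Let lo : R := Num.max 0 (x - c).
Let hi : R := Num.min 1 (x + c).
(** In units of [psi x], and up to a factor [1 + 2 * theta], this bounds what [A] subtracts from the
    excess inside the window. *)
Let L : R := Iuv \1_A lo hi / alpha.
Let g : R := hit_slope x.
Let a y : R := Num.min 1 (psi y / psi x).

Lemma window_bounds : [/\ 0 <= lo, x - c <= lo, lo <= x, x <= hi & hi <= 1 /\ hi <= x + c].
Proof.
have [_ _ /andP[c0 _] _ _ _] := sc; case/andP: x01 => x0 x1.
rewrite /lo /hi !le_max !ge_max !le_min !ge_min !lexx ?orbT ?x0 ?x1/=.
by split => //; lra.
Qed.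

Lemma window_sub z : lo <= z <= hi -> 0 <= z <= 1 /\ `|z - x| <= c.
Proof.
have [l0 lc lx xh [h1 hc]] := window_bounds => /andP[lz zh].
by rewrite ler_norml; split; apply/andP; split; lra.
Qed.

Lemma psix_gt0 : 0 < psi x. Proof. exact: psi_gt0. Qed.

Lemma ratio_near_one z : lo <= z <= hi -> `|psi z / psi x - 1| <= 2 * theta.
Proof.
move=> zw; have [z01 zc] := window_sub z zw; have := taylor z z01 zc.
have [xz|zx] := leP x z.
  rewrite (ger0_norm (x := z - x)) ?subr_ge0// => tz.
  apply: (near_one sc (b := b) (t := z - x)) => //.
  by rewrite subr_ge0 xz; rewrite ger0_norm ?subr_ge0// in zc.
rewrite (ltr0_norm (x := z - x)) ?subr_lt0// opprB => tz.
apply: (near_one sc (b := - b) (t := x - z)) => //; first by rewrite normrN.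
  by rewrite subr_ge0 ltW//; rewrite ltr0_norm ?subr_lt0// opprB in zc.
by rewrite (_ : - b * (x - z) = b * (z - x))//; ring.
Qed.

Lemma L_ge0 : 0 <= L.
Proof.
rewrite divr_ge0 ?(ltW alpha_gt0)//; apply: Iuv_ge0 => z _.
by case/andP: (indicA_itv z).
Qed.

Lemma excess_increment u v : lo <= u -> u <= v -> v <= hi ->
  psi x * ((v - u) * (1 - 2 * theta) - (1 + 2 * theta) * L) <= Iuv excess u v.
Proof.
move=> lu uv vh; have [l0 lc lx xh [h1 hc]] := window_bounds.
have th := small_scale_theta sc; have [_ _ _ th0 _ _] := sc.
have u0 : 0 <= u by lra.
have v1 : v <= 1 by lra.
have px := psix_gt0.
have p0 : 0 < target_mass^-1 by rewrite invr_gt0 target_mass_gt0.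
have bI k : bm (fun z => k * \1_A z) by exact: bmM (bm_cst _) bm_indicA.
pose k := target_mass^-1 * (psi x * (1 + 2 * theta)).
apply: (@le_trans _ _ (Iuv (fun z => psi x * (1 - 2 * theta) - k * \1_A z) u v)).
  rewrite IuvB//; last exact: bm_cst.
  rewrite Iuv_cst// IuvZ//; last exact: bm_indicA.
  have IA : Iuv \1_A u v <= Iuv \1_A lo hi.
    rewrite (@Iuv_split _ lo hi l0 h1 _ u bm_indicA) ?lu ?(le_trans uv)//.
    rewrite (@Iuv_split _ u hi u0 h1 _ v bm_indicA) ?vh ?uv//.
    have Ige (w t : R) : 0 <= Iuv (\1_A) w t :> R.
      by apply: Iuv_ge0 => z _; case/andP: (indicA_itv z).
    have := Ige lo u; have := Ige v hi; lra.
  have I0 : 0 <= Iuv \1_A u v :> R.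
    by apply: Iuv_ge0 => z _; case/andP: (indicA_itv z).
  have pIL : target_mass^-1 * Iuv \1_A u v <= L.
    rewrite mulrC /L ler_pM// ?(ltW p0)//.
    by rewrite lef_pV2 ?posrE// target_mass_gt0.
  have -> : k * Iuv \1_A u v = psi x * ((1 + 2 * theta) * (target_mass^-1 * Iuv \1_A u v)).
    by rewrite /k; ring.
  have -> : psi x * (1 - 2 * theta) * (v - u) = psi x * ((v - u) * (1 - 2 * theta)) by ring.
  rewrite -mulrBr; apply: ler_wpM2l; first exact: ltW.
  by apply: lerB => //; apply: ler_wpM2l => //; lra.
apply: le_Iuv => //; first by apply: bmB => //; exact: bm_cst.
  exact: bm_excess.
move=> z /andP[uz zv]; rewrite /excess.
have zw : lo <= z <= hi by apply/andP; split; lra.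
have := ratio_near_one z zw; rewrite ler_norml => /andP[].
rewrite lerBrDr lerBlDr ler_pdivlMr// ler_pdivrMr// => r1 r2.
have /andP[A0 A1] := indicA_itv z.
apply: lerB; first by lra.
rewrite /k -mulrA; apply: ler_wpM2l; first exact: ltW.
by apply: ler_wpM2r => //; lra.
Qed.

(** Normalizing by [psi x] gives the form [N / u] treated by [quotient_lower]. *)
Lemma slopeE z : 0 <= z <= 1 ->
  hit_slope z = (prim excess z / psi x) / (psi z / psi x).
Proof.
move=> z01; rewrite /hit_slope invf_div mulrA; congr (_ * _).
by rewrite divfK// gt_eqF// psix_gt0.
Qed.

Lemma hit_slope_right z : x <= z <= hi ->
  g * (1 - b * (z - x)) + 4 / 5 * (z - x) - 3 / 2 * L <= hit_slope z.
Proof.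
move=> /andP[xz zh]; have [l0 lc lx xh [h1 hc]] := window_bounds.
have zw : lo <= z <= hi by apply/andP; split; lra.
have [z01 zc] := window_sub z zw; rewrite (slopeE z z01).
have tz := taylor z z01 zc.
have zx0 : 0 <= z - x by rewrite subr_ge0.
rewrite (ger0_norm zx0) in tz zc.
apply: (quotient_lower sc (u := psi z / psi x) (t := z - x)) => //.
- by rewrite zx0 zc.
- exact: L_ge0.
have := excess_increment x z lx xz zh.
have px := psix_gt0.
rewrite -primB ?bm_excess//; [|exact: bm_excess|by case/andP: x01|lra].
rewrite ler_pdivlMr// /g /hit_slope => incr.
have : prim excess x * (psi x)^-1 * psi x = prim excess x by rewrite divfK// gt_eqF.
move: incr; set G := prim _ x * _; lra.
Qed.

Lemma hit_slope_left z : lo <= z <= x ->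
  hit_slope z <= g * (1 - b * (z - x)) + 4 / 5 * (z - x) + 3 / 2 * L.
Proof.
move=> /andP[lz zx]; have [l0 lc lx xh [h1 hc]] := window_bounds.
have zw : lo <= z <= hi by apply/andP; split; lra.
have [z01 zc] := window_sub z zw; rewrite (slopeE z z01).
have tz := taylor z z01 zc.
have zx0 : 0 <= x - z by rewrite subr_ge0.
rewrite (distrC z x) (ger0_norm zx0) in tz zc.
(* Reflection about [x] replaces [g], [b] and [z - x] by their opposites, which brings the left side
   under the same scalar lemma. *)
suff : - g * (1 - (- b) * (x - z)) + 4 / 5 * (x - z) - 3 / 2 * L <=
    (- (prim excess z / psi x)) / (psi z / psi x) by rewrite mulNr; lra.
apply: (quotient_lower sc (u := psi z / psi x) (t := x - z)) => //.
- by rewrite normrN.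
- by rewrite normrN.
- by rewrite zx0 zc.
- by rewrite (_ : - b * (x - z) = b * (z - x))//; ring.
- exact: L_ge0.
have := excess_increment z x lz zx xh.
have px := psix_gt0.
rewrite -primB//; [|exact: bm_excess|lra|by case/andP: x01].
rewrite lerNr ler_pdivrMr// /g /hit_slope => incr.
have : prim excess x * (psi x)^-1 * psi x = prim excess x by rewrite divfK// gt_eqF.
move: incr; set G := prim _ x * _; lra.
Qed.

Lemma accepted_right y : x <= y <= hi ->
  g * ((y - x) - `|b| * (y - x) ^+ 2 / 2) + (y - x) ^+ 2 / 4 - 2 * c * L <=
  a y * (prim hit_slope y - prim hit_slope x).
Proof.
move=> /andP[xy yh]; have [l0 lc lx xh [h1 hc]] := window_bounds.
have yw : lo <= y <= hi by apply/andP; split; lra.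
have [y01 yc] := window_sub y yw.
have ty := taylor y y01 yc.
have yx0 : 0 <= y - x by rewrite subr_ge0.
rewrite (ger0_norm yx0) in ty yc.
apply: (accepted_lower sc) => //.
- by rewrite yx0 yc.
- exact: L_ge0.
have y1 : y <= 1 by lra.
have x0 : 0 <= x by lra.
rewrite primB//; last exact: bm_hit_slope.
apply: (@le_trans _ _ (Iuv (fun z => (g - 3 / 2 * L) + (4 / 5 - g * b) * (z - x)
   + 0 * (z - x) ^+ 2) x y)).
  by rewrite Iuv_poly// subrr expr0n/= subr0 !mul0r addr0.
apply: le_Iuv => //; first 1 last.
- exact: bm_hit_slope.
- move=> z /andP[xz zy]; have xzh : x <= z <= hi by rewrite xz (le_trans zy).
  have := hit_slope_right z xzh; lra.
exact: bm_poly2.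
Qed.

Lemma accepted_left y : lo <= y <= x ->
  - g * ((x - y) - `|b| * (x - y) ^+ 2 / 2) + (x - y) ^+ 2 / 4 - 2 * c * L <=
  a y * (prim hit_slope y - prim hit_slope x).
Proof.
move=> /andP[ly yx]; have [l0 lc lx xh [h1 hc]] := window_bounds.
have yw : lo <= y <= hi by apply/andP; split; lra.
have [y01 yc] := window_sub y yw.
have ty := taylor y y01 yc.
have yx0 : 0 <= x - y by rewrite subr_ge0.
rewrite (distrC y x) (ger0_norm yx0) in ty yc.
rewrite -(normrN b).
apply: (accepted_lower sc) => //.
- by rewrite normrN.
- by rewrite normrN.
- by rewrite yx0 yc.
- by rewrite (_ : - b * (x - y) = b * (y - x))//; ring.
- exact: L_ge0.
have y0 : 0 <= y by lra.
have x1 : x <= 1 by lra.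
have -> : prim hit_slope y - prim hit_slope x = - Iuv hit_slope y x.
  by rewrite -opprB primB//; exact: bm_hit_slope.
suff : Iuv hit_slope y x <=
    Iuv (fun z => (g + 3 / 2 * L) + (4 / 5 - g * b) * (z - x) + 0 * (z - x) ^+ 2) y x.
  rewrite Iuv_poly// subrr expr0n/= -(sqrrN (y - x)) opprB !mul0r addr0.
  by move=> ?; lra.
apply: le_Iuv => //; [exact: bm_hit_slope|exact: bm_poly2|].
move=> z /andP[yz zx]; have lzx : lo <= z <= x by rewrite zx (le_trans ly).
have := hit_slope_left z lzx; lra.
Qed.

Lemma acceptance_ge_half y : lo <= y <= hi -> 2^-1 <= a y.
Proof.
move=> /ratio_near_one; rewrite ler_norml => /andP[h _].
have th := small_scale_theta sc; rewrite le_min; apply/andP; split; lra.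
Qed.

Lemma bm_acceptance : bm a.
Proof.
apply: bm_min1; apply: (bmM _ _ bpsi); exact: bm_cst.
Qed.

(** Near [0] the primitive at [x] is an integral over [[0, x]], inside the window, so [A] can push
    it below zero only by a multiple of [L]; near [1] the zero total excess gives the mirror bound.
    As [c <= 1 / 2], at most one side of the window is cut. *)
Lemma slope_boundary : let l := x - lo in let e := hi - x in
  [\/ l = c /\ e = c, e = c /\ - (2 * L) <= g | l = c /\ g <= 2 * L].
Proof.
have [l0 lc lx xh [h1 hc]] := window_bounds => l e.
have th := small_scale_theta sc; have [_ _ _ th0 _ _] := sc.
have px := psix_gt0; have L0 := L_ge0; have ch := c_half.
have tL : theta * L <= 100^-1 * L by rewrite ler_wpM2r.
have gE : prim excess x = psi x * g.
  by rewrite /g /hit_slope mulrC divfK// gt_eqF.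
have /andP[x0 x1] := x01.
have [xc|cx] := ltP x c.
  have loE : lo = 0 by rewrite /lo max_l//; lra.
  apply: Or32; split; first by rewrite /e /hi min_r; lra.
  have l0' : lo <= 0 by rewrite loE.
  have := excess_increment 0 x l0' x0 xh.
  rewrite -/(prim excess x) gE ler_pM2l// => h.
  have x2 : 0 <= x * (1 - 2 * theta) by rewrite mulr_ge0//; lra.
  lra.
have lE : l = c by rewrite /l /lo max_r; lra.
have [xc1|cx1] := leP x (1 - c).
  by apply: Or31; split => //; rewrite /e /hi min_r; lra.
have hiE : hi = 1 by rewrite /hi min_l//; lra.
apply: Or33; split => //.
have h1' : 1 <= hi by rewrite hiE.
have := excess_increment x 1 lx x1 h1'.
rewrite -primB//; last exact: bm_excess.
rewrite prim_excess1 sub0r gE -(mulrN (psi x) g) ler_pM2l// => h.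
have x2 : 0 <= (1 - x) * (1 - 2 * theta) by rewrite mulr_ge0//; lra.
lra.
Qed.

(** The integral omits the proposal factor [(2 * c)^-1] and rejected moves contribute nothing, so
    [- (4 * c)] means an expected change of at most [- 2] per step. *)
Lemma lyapunov_drift r0 : ~ A x ->
  (forall y, 0 <= y <= 1 -> prim hit_slope y <= r0) ->
  Iuv (fun y => a y * (lyapunov r0 c y - lyapunov r0 c x)) lo hi <= - (4 * c).
Proof.
move=> nAx r0P; have [l0 lc lx xh [h1 hc]] := window_bounds.
have [_ _ /andP[c0 _] _ _ _] := sc; have /andP[x0 x1] := x01.
pose K := 48 * c ^- 2; pose M' := 576 / alpha.
have K0 : 0 <= K by rewrite mulr_ge0// invr_ge0 sqr_ge0.
have M0 : 0 <= M' by apply: divr_ge0; [exact: ler0n|exact: ltW alpha_gt0].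
(* Off [A] this is an equality. On [A] the function drops to [0]: the nonnegative barrier at [y] is
   discarded, and at least half of the height [M'] is gained because the acceptance is at least
   [1 / 2]. *)
have pointwise y : lo <= y <= hi ->
    a y * (lyapunov r0 c y - lyapunov r0 c x) <=
    - K * (a y * (prim hit_slope y - prim hit_slope x)) - M' / 2 * \1_A y.
  move=> yw; have [y01 _] := window_sub y yw; have ha := acceptance_ge_half y yw.
  have H0 : 0 <= K * (r0 - prim hit_slope y) by rewrite mulr_ge0// subr_ge0 r0P.
  rewrite /lyapunov /barrier -/K -/M' [\1_A x]indicE memNset// subr0 mulr1.
  rewrite /indic; case: (_ \in _); rewrite /= ?subrr ?mulr0 ?subr0 ?mulr1.
    have : 2^-1 * M' <= a y * (K * (r0 - prim hit_slope y) + M').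
      by apply: ler_pM => //; rewrite lerDr.
    lra.
  lra.
pose S := (fun y => a y * (lyapunov r0 c y - lyapunov r0 c x)).
have bS : bm S.
  by apply: (bmM _ _ bm_acceptance); apply: bmB; [exact: bm_lyapunov|exact: bm_cst].
have bI : bm (fun y => M' / 2 * \1_A y) by apply: bmM; [exact: bm_cst|exact: bm_indicA].
have bP q1 q2 q3 : bm (fun y => - K * (q1 + q2 * (y - x) + q3 * (y - x) ^+ 2)).
  by apply: bmM; [exact: bm_cst|exact: bm_poly2].
(* The two halves of the window are integrated separately; their terms in [g] have opposite signs
   and are balanced by [window_moment]. *)
have right : Iuv S x hi <= - K * (- (2 * c * L) * (hi - x) + g * (hi - x) ^+ 2 / 2
    + (4^-1 - g * `|b| / 2) * (hi - x) ^+ 3 / 3) - M' / 2 * Iuv \1_A x hi.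
  apply: (@le_trans _ _ (Iuv (fun y => - K * (- (2 * c * L) + g * (y - x)
     + (4^-1 - g * `|b| / 2) * (y - x) ^+ 2) - M' / 2 * \1_A y) x hi)).
    apply: le_Iuv => //; first exact: bmB.
    move=> y /andP[xy yh]; apply: le_trans (pointwise y _) _; first by rewrite yh (le_trans lx).
    rewrite lerD2r !mulNr lerN2 ler_wpM2l//.
    have xyh : x <= y <= hi by rewrite xy.
    have := accepted_right y xyh; lra.
  rewrite IuvB// IuvZ//; last exact: bm_poly2.
  rewrite IuvZ//; last exact: bm_indicA.
  by rewrite Iuv_poly// subrr !expr0n/= !subr0.
have left : Iuv S lo x <= - K * (- (2 * c * L) * (x - lo) - g * (x - lo) ^+ 2 / 2
    + (4^-1 + g * `|b| / 2) * (x - lo) ^+ 3 / 3) - M' / 2 * Iuv \1_A lo x.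
  apply: (@le_trans _ _ (Iuv (fun y => - K * (- (2 * c * L) + g * (y - x)
     + (4^-1 + g * `|b| / 2) * (y - x) ^+ 2) - M' / 2 * \1_A y) lo x)).
    apply: le_Iuv => //; first exact: bmB.
    move=> y /andP[ly yx]; apply: le_trans (pointwise y _) _; first by rewrite ly (le_trans yx).
    rewrite lerD2r !mulNr lerN2 ler_wpM2l//.
    have lyx : lo <= y <= x by rewrite ly.
    have := accepted_left y lyx; rewrite -(sqrrN (x - y)) opprB; lra.
  rewrite IuvB// IuvZ//; last exact: bm_poly2.
  rewrite IuvZ//; last exact: bm_indicA.
  rewrite Iuv_poly// subrr !expr0n/= (_ : lo - x = - (x - lo)); last by ring.
  rewrite sqrrN lerD2r !mulNr lerN2 ler_wpM2l//.
  by rewrite (_ : (- (x - lo)) ^+ 3 = - (x - lo) ^+ 3); [lra|ring].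
rewrite -/S (@Iuv_split _ lo hi l0 h1 S x bS) ?lx ?xh//.
have lam : Iuv \1_A lo x + Iuv \1_A x hi = alpha * L.
  rewrite -(@Iuv_split _ lo hi l0 h1 _ x bm_indicA) ?lx ?xh// /L.
  by rewrite mulrCA divff ?mulr1// gt_eqF.
have lr : 0 <= x - lo <= c by apply/andP; split; lra.
have er : 0 <= hi - x <= c by apply/andP; split; lra.
have := window_moment sc b_le L_ge0 lr er slope_boundary.
set W := (X in _ <= X) => moment.
(* Scaling by [K] gives [4 * c - 240 * L], while jumps into [A] return [288 * L]; this is why the
   height is [576 / alpha]. *)
have KW : K * (c ^+ 3 / 12 - 5 * c ^+ 2 * L) <= K * W by rewrite ler_wpM2l.
have KE : K * (c ^+ 3 / 12 - 5 * c ^+ 2 * L) = 4 * c - 240 * L.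
  by rewrite /K; field; rewrite gt_eqF.
have ML : M' / 2 * (Iuv \1_A lo x + Iuv \1_A x hi) = 288 * L.
  by rewrite lam /M'; field; rewrite gt_eqF.
have L0 := L_ge0.
have WE : W = (- (2 * c * L) * (hi - x) + g * (hi - x) ^+ 2 / 2
    + (4^-1 - g * `|b| / 2) * (hi - x) ^+ 3 / 3) +
   (- (2 * c * L) * (x - lo) - g * (x - lo) ^+ 2 / 2
    + (4^-1 + g * `|b| / 2) * (x - lo) ^+ 3 / 3) by rewrite /W; field.
rewrite KE WE in KW; rewrite mulrDr in ML KW.
move: left right; rewrite !mulNr => left right.
lra.
Qed.

End local.
End lyapunov.

(** * The Metropolis--Hastings kernel: real formula, measurability, hitting times *)

Section metropolis_kernel.
Context {R : realType}.
Local Notation bm := bounded_measurable01.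
Local Notation mu := (@lebesgue_measure R).
Variables (psi : R -> R) (c : R).
Hypotheses (bpsi : bm psi) (bpsiV : bm (fun z => (psi z)^-1)) (c_gt0 : 0 < c).
Hypothesis psi_gt0 : forall z, 0 <= z <= 1 -> 0 < psi z.

Definition acceptance_density x y : R := (2 * c)^-1 * Num.min 1 (psi y / psi x).

Local Notation w := acceptance_density.
Local Notation lo x := (Num.max 0 (x - c)).
Local Notation hi x := (Num.min 1 (x + c)).

Lemma bm_acceptance_density x : bm (w x).
Proof.
apply: bmM; first exact: bm_cst.
by apply: bm_min1; apply: (bmM _ _ bpsi); exact: bm_cst.
Qed.

Lemma lo_ge0 x : 0 <= lo x. Proof. by rewrite le_max lexx. Qed.
Lemma hi_le1 x : hi x <= 1. Proof. by rewrite ge_min lexx. Qed.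

Lemma window_itv x : `[0 : R, 1] `&` `[x - c, x + c] = `[lo x, hi x]%classic.
Proof.
apply/seteqP; split=> y /=; rewrite !in_itv/= ge_max le_min.
  by move=> [/andP[-> ->] /andP[-> ->]].
by move=> /andP[/andP[-> ->] /andP[-> ->]].
Qed.

Lemma mh_massE x (B : set R) : measurable B -> B `<=` `[0, 1] ->
  mh_mass psi c x B = (Iuv (fun y => \1_B y * w x y) (lo x) (hi x))%:E.
Proof.
move=> mB B01; rewrite /mh_mass.
have -> : B `&` `[x - c, x + c] = B `&` `[lo x, hi x]%classic.
  by rewrite -window_itv setIA (setIidl B01).
rewrite integral_mkcondl /Iuv /Rintegral fineK; last first.
  apply: integrable_fin_num => //; apply: bm_integrable; [|exact: lo_ge0|exact: hi_le1].
  by apply: bmM; [exact: bm_indic|exact: bm_acceptance_density].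
apply: eq_integral => y _; rewrite /patch indicE.
by case: (y \in B); rewrite ?mul1r ?mul0r.
Qed.

Lemma acceptance_density_bounds x y : 0 <= x <= 1 -> 0 <= y <= 1 ->
  0 <= w x y <= (2 * c)^-1.
Proof.
move=> x01 y01; have c2 : 0 < (2 * c)^-1 by rewrite invr_gt0 mulr_gt0.
apply/andP; split.
  by rewrite mulr_ge0 ?(ltW c2)// le_min ler01 divr_ge0// ltW// psi_gt0.
by rewrite /w ler_piMr ?(ltW c2)// ge_min lexx.
Qed.

Lemma window_order x : 0 <= x <= 1 -> lo x <= x <= hi x /\ hi x - lo x <= 2 * c.
Proof.
move=> /andP[x0 x1]; have c0 := c_gt0; split.
  by rewrite ge_max le_min x0 x1/=; apply/andP; split; lra.
have h : hi x <= x + c by rewrite ge_min lexx orbT.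
have l : x - c <= lo x by rewrite le_max lexx orbT.
lra.
Qed.

Lemma window01 x y : lo x <= y <= hi x -> 0 <= y <= 1.
Proof.
by move=> /andP[ly yh]; rewrite (le_trans (lo_ge0 x) ly) (le_trans yh (hi_le1 x)).
Qed.

Lemma Iuv_acceptance_le1 x : 0 <= x <= 1 -> Iuv (w x) (lo x) (hi x) <= 1.
Proof.
move=> x01; have [/andP[lx xh] hl] := window_order x x01.
have c2 : 0 < 2 * c by rewrite mulr_gt0.
apply: (@le_trans _ _ (Iuv (fun=> (2 * c)^-1) (lo x) (hi x))).
  apply: le_Iuv; [exact: lo_ge0|exact: hi_le1|exact: bm_acceptance_density|exact: bm_cst|].
  by move=> y /window01 y01; have /andP[] := acceptance_density_bounds x y x01 y01.
by rewrite Iuv_cst ?(le_trans lx)// mulrC ler_pdivrMr// mul1r.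
Qed.

Lemma mh_kernelE x (B : set R) : measurable B -> B `<=` `[0, 1] ->
  mh_kernel psi c x B = (Iuv (fun y => \1_B y * w x y) (lo x) (hi x) +
    \1_B x * (1 - Iuv (w x) (lo x) (hi x)))%:E.
Proof.
move=> mB B01; rewrite /mh_kernel !mh_massE//.
rewrite (@eq_Iuv _ (fun y => \1_`[0 : R, 1] y * w x y) (w x) (lo x) (hi x)) // => y /window01 y01.
by rewrite indicE mem_set ?mul1r//= in_itv.
Qed.

Lemma mh_kernel_ge0 x (B : set R) : 0 <= x <= 1 -> measurable B -> B `<=` `[0, 1] ->
  (0 <= mh_kernel psi c x B)%E.
Proof.
move=> x01 mB B01; rewrite mh_kernelE// lee_fin addr_ge0//.
  apply: Iuv_ge0 => y /window01 y01; rewrite mulr_ge0//.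
  by have /andP[] := acceptance_density_bounds x y x01 y01.
by rewrite mulr_ge0// subr_ge0 Iuv_acceptance_le1.
Qed.

(** By Tonelli, as a partial integral of a nonnegative jointly measurable function. *)
Lemma measurable_mh_mass (B : set R) : measurable B -> B `<=` `[0, 1] ->
  measurable_fun `[0 : R, 1] (fun x => mh_mass psi c x B).
Proof.
move=> mB B01.
(* [psi] and its inverse are extended by [0] outside [[0, 1]], where nothing is known about them, to
   be measurable on the whole line. *)
pose psi01 : R -> R := psi \_ `[0, 1].
pose psiV01 : R -> R := (fun z => (psi z)^-1) \_ `[0, 1].
have mpsi : measurable_fun setT psi01.
  by apply/(measurable_restrictT psi) => //; case: bpsi.
have mpsiV : measurable_fun setT psiV01.
  by apply/(measurable_restrictT (fun z => (psi z)^-1)) => //; case: bpsiV.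
have psi01_ge0 z : 0 <= psi01 z.
  rewrite /psi01 /patch; case: ifPn => //; rewrite inE/= in_itv/= => z01.
  exact/ltW/psi_gt0.
have psiV01_ge0 z : 0 <= psiV01 z.
  rewrite /psiV01 /patch; case: ifPn => //; rewrite inE/= in_itv/= => z01.
  by rewrite invr_ge0; exact/ltW/psi_gt0.
pose f (z : R * R) : R := \1_B z.2 * ((2 * c)^-1 * Num.min 1 (psi01 z.2 * psiV01 z.1)).
(* The window becomes a condition on the pair, so the domain of integration no longer moves with
   [x]. *)
pose F (z : R * R) : \bar R :=
  (if (z.1 - c <= z.2) && (z.2 <= z.1 + c) then f z else 0)%:E.
have c2 : 0 < (2 * c)^-1 by rewrite invr_gt0 mulr_gt0.
have F0 z : (0 <= F z)%E.
  rewrite lee_fin; case: ifP => // _; rewrite mulr_ge0// mulr_ge0 ?(ltW c2)//.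
  by rewrite le_min ler01 mulr_ge0.
have mF : measurable_fun setT F.
  apply/measurable_EFinP; apply: measurable_fun_ifT.
  - apply: measurable_and; apply: measurable_fun_ler.
    + apply: measurable_funB => //; exact: measurable_fst.
    + exact: measurable_snd.
    + exact: measurable_snd.
    + apply: measurable_funD => //; exact: measurable_fst.
  - apply: measurable_funM.
      exact: (measurableT_comp (measurable_indic mB) measurable_snd).
    apply: measurable_funM => //; apply: measurable_minr => //.
    apply: measurable_funM; first exact: (measurableT_comp mpsi measurable_snd).
    exact: (measurableT_comp mpsiV measurable_fst).
  - exact: measurable_cst.
have /(@measurable_funTS _ _ _ _ `[0 : R, 1]) := measurable_fun_fubini_tonelli_F (m2 := mu) _ mF F0.
apply: eq_measurable_fun => x; rewrite inE/= in_itv/= => x01.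
rewrite /fubini_F /mh_mass [RHS]integral_mkcond; apply: eq_integral => y _.
have xin : x \in `[0 : R, 1]%classic by rewrite inE/= in_itv.
rewrite /patch /F /f /psiV01 /psi01 /patch xin/=.
have [yB|yB] := boolP (y \in B); last first.
  rewrite indicE (negbTE yB) mul0r if_same; case: ifPn => //.
  by rewrite inE/= => -[] /mem_set; rewrite (negbTE yB).
have y01 := B01 _ (set_mem yB); rewrite indicE yB mul1r (mem_set y01).
case: ifPn => [/andP[y1 y2]|yW].
  by rewrite mem_set//; split; [exact: set_mem|rewrite /= in_itv/= y1].
by rewrite memNset// => -[_] /=; rewrite in_itv/= (negbTE yW).
Qed.

Lemma measurable_mh_kernel (B : set R) : measurable B -> B `<=` `[0, 1] ->
  measurable_fun `[0 : R, 1] (fun x => mh_kernel psi c x B).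
Proof.
move=> mB B01; apply: emeasurable_funD; first exact: measurable_mh_mass.
apply: emeasurable_funM.
  by apply/measurable_EFinP; exact: measurable_indic.
by apply: emeasurable_funB => //; exact: measurable_mh_mass.
Qed.

(** The sum counts the natural numbers below [t], hence is the ceiling of [t]; [t <= N] ensures that
    none is missed. *)
Lemma sum_lt_bounds (N : nat) (t : R) : 0 <= t <= N%:R ->
  t <= \sum_(0 <= j < N) (j%:R < t)%R%:R <= t + 1.
Proof.
elim: N => [|N IH] /andP[t0 tN].
  by rewrite big_nil; apply/andP; split; lra.
rewrite big_nat_recr//=; have [Nt|tN'] := ltP N%:R t; last first.
  by rewrite addr0 IH// t0.
have -> : \sum_(0 <= j < N) (j%:R < t)%R%:R = N%:R :> R.
  transitivity (\sum_(0 <= j < N) (1 : R)); last by rewrite sumr_const_nat subn0.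
  apply: eq_big_nat => j /andP[_ jN]; rewrite (lt_trans _ Nt)// ltr_nat//.
rewrite natr1; apply/andP; split => //.
by move: tN Nt; rewrite -natr1 => tN Nt; lra.
Qed.

Lemma Iuv_sum (N : nat) (F : nat -> R -> R) u v : 0 <= u -> v <= 1 -> u <= v ->
  (forall j, bm (F j)) ->
  bm (fun y => \sum_(0 <= j < N) F j y) /\
  Iuv (fun y => \sum_(0 <= j < N) F j y) u v = \sum_(0 <= j < N) Iuv (F j) u v.
Proof.
move=> u0 v1 uv bF; elim: N => [|N [bN IN]].
  have -> : (fun y => \sum_(0 <= j < 0) F j y) = fun=> 0.
    by apply/funext => y; rewrite big_nil.
  by rewrite big_nil Iuv_cst// mul0r; split => //; exact: bm_cst.
have E : (fun y => \sum_(0 <= j < N.+1) F j y) = (fun y => \sum_(0 <= j < N) F j y + F N y).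
  by apply/funext => y; rewrite big_nat_recr.
by rewrite E IuvD// IN big_nat_recr//; split => //; exact: bmD.
Qed.

(* The sum of the indicators of the superlevel sets [j < h] rounds [h] up to
   an integer, which costs at most one unit of drift. *)
Lemma mh_expected_hitting_time_le (A : set R) (h : R -> R) (N : nat) (x : R)
    (d : measure_display) (Omega : measurableType d) (P : probability Omega R)
    (X : nat -> {RV P >-> R}) :
  measurable A -> bm h -> (forall y, 0 <= y <= 1 -> 0 <= h y <= N%:R) ->
  (forall y, A y -> h y <= 0) ->
  (forall z, 0 <= z <= 1 -> ~ A z ->
    Iuv (fun y => Num.min 1 (psi y / psi z) * (h y - h z)) (lo z) (hi z) <= - (4 * c)) ->
  markov_chain (mh_kernel psi c) x X ->
  (\int[P]_w hitting_time X A w <= N%:R%:E)%E.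
Proof.
move=> mA bh hN hA drift chainX.
pose B (j : nat) : set R := `[0, 1] `&` h @^-1` `]j%:R, +oo[.
have mB j : measurable (B j) by case: bh => mh _; exact: mh.
have B01 j : B j `<=` `[0, 1] by move=> y [].
apply: (@expected_hitting_time_le _ _ _ _ _ _ _ x N B chainX mA mB).
- move=> j y [y01 hy]; split => // /hA; move: hy; rewrite /= in_itv/= andbT => jh h0.
  by have := lt_le_trans jh h0; rewrite ltNge ler0n.
- by move=> j; exact: measurable_mh_kernel.
- by move=> j y; rewrite in_itv/= => y01; exact: mh_kernel_ge0.
move=> z; rewrite in_itv/= => z01 nAz.
pose S (y : R) : R := \sum_(0 <= j < N) \1_(B j) y.
have SP y : 0 <= y <= 1 -> h y <= S y <= h y + 1.
  move=> y01; have -> : S y = \sum_(0 <= j < N) (j%:R < h y)%R%:R.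
    apply: eq_bigr => j _; rewrite indicE; congr (_%:R); congr nat_of_bool.
    apply/idP/idP => [/set_mem[_]|jh]; first by rewrite /= in_itv/= andbT.
    by apply/mem_set; split; rewrite /= in_itv/= ?andbT.
  by apply: sum_lt_bounds; exact: hN.
have [/andP[lz zh] hl] := window_order z z01.
have lh : lo z <= hi z by exact: le_trans lz zh.
have l0 := lo_ge0 z; have h1 := hi_le1 z.
have bw := bm_acceptance_density z.
have bB j : bm (\1_(B j)) by exact: bm_indic.
have bBw j : bm (fun y => \1_(B j) y * w z y) by exact: bmM.
have [bS _] := Iuv_sum N (fun j => \1_(B j)) (lo z) (hi z) l0 h1 lh bB.
have [_ IS] := Iuv_sum N (fun j y => \1_(B j) y * w z y) (lo z) (hi z) l0 h1 lh bBw.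
have ISw : Iuv (fun y => S y * w z y) (lo z) (hi z) =
    \sum_(0 <= j < N) Iuv (fun y => \1_(B j) y * w z y) (lo z) (hi z).
  by rewrite -IS; apply: eq_Iuv => y _; rewrite /S mulr_suml.
have W1 := Iuv_acceptance_le1 z z01.
under eq_bigr do rewrite mh_kernelE//.
rewrite !sumEFin -EFinD lee_fin big_split/= -ISw -mulr_suml -/(S z).
(* The holding part of the kernel weighs [S z] by one minus the accepted mass, so only accepted
   jumps remain. *)
suff : Iuv (fun y => S y * w z y) (lo z) (hi z) - S z * Iuv (w z) (lo z) (hi z) <= - 1.
  by lra.
have bSz : bm (fun y => S z * w z y) by apply: bmM => //; exact: bm_cst.
have bSw : bm (fun y => S y * w z y) by exact: bmM.
rewrite -IuvZ// -IuvB//.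
pose D y := Num.min 1 (psi y / psi z) * (h y - h z).
have bD : bm D.
  apply: bmM; last by apply: bmB => //; exact: bm_cst.
  by apply: bm_min1; apply: (bmM _ _ bpsi); exact: bm_cst.
have bcD : bm (fun y => (2 * c)^-1 * D y) by apply: bmM => //; exact: bm_cst.
(* Rounding up gives [S y - S z <= h y + 1 - h z]; the extra [1] is integrated against an accepted
   mass of at most [1], which leaves [- 2 + 1]. *)
apply: (@le_trans _ _ (Iuv (fun y => (2 * c)^-1 * D y + w z y) (lo z) (hi z))).
  apply: le_Iuv => //; [exact: bmB|exact: bmD|].
  move=> y /window01 y01; have /andP[w0 _] := acceptance_density_bounds z y z01 y01.
  have -> : (2 * c)^-1 * D y + w z y = (h y + 1 - h z) * w z y.
    by rewrite /D /w; ring.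
  rewrite -mulrBl ler_wpM2r//.
  have /andP[_ s1] := SP y y01; have /andP[s2 _] := SP z z01; lra.
rewrite IuvD// IuvZ//.
have : (2 * c)^-1 * Iuv D (lo z) (hi z) <= - 2.
  by rewrite mulrC ler_pdivrMr ?mulr_gt0//; apply: le_trans (drift z z01 nAz) _; lra.
lra.
Qed.

End metropolis_kernel.

(** * Choice of the threshold and range of the Lyapunov function *)

Section threshold.
Context {R : realType}.
Local Notation bm := bounded_measurable01.

Lemma continuous_inv01 (f : R -> R) : (forall z, 0 <= z <= 1 -> 0 < f z) ->
  {within `[0 : R, 1], continuous f} -> {within `[0 : R, 1], continuous (fun z => (f z)^-1)}.
Proof.
move=> f0 /subspace_continuousP cf; apply/subspace_continuousP => x x01.
apply: cvgV; last exact: cf.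
by rewrite gt_eqF// f0//; move: x01; rewrite /= in_itv.
Qed.

Lemma density01_mass (psi : R -> R) : density01 psi -> Iuv psi 0 1 = 1.
Proof. by move=> [_ _]; rewrite /Iuv /Rintegral => ->. Qed.

Lemma density_measureE (psi : R -> R) (A : set R) : bm psi -> measurable A ->
  A `<=` `[0, 1] -> density_measure psi A = (target_mass psi A)%:E.
Proof.
move=> bpsi mA A01; rewrite /density_measure -[X in integral _ X](setIidl A01).
rewrite integral_mkcondl.
rewrite /target_mass /Iuv /Rintegral fineK; last first.
  apply: integrable_fin_num => //; apply: bm_integrable => //.
  exact: (bmM _ _ bpsi (bm_indic _ mA)).
apply: eq_integral => y _; rewrite /patch indicE.
by case: (y \in A); rewrite ?mulr1 ?mulr0.
Qed.

(** One [C] serves all sets [A] and all slope bounds [r0], so that the threshold is a function of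
    [psi] and [alpha]. *)
Definition drift_threshold (psi : R -> R) (alpha C : R) : Prop :=
  forall c, 0 < c -> C < c^-1 -> c <= 1 /\
  forall A : set R, measurable A -> alpha <= target_mass psi A ->
  forall r0, (forall z, 0 <= z <= 1 -> `|hit_slope psi A z| <= r0) ->
  forall x, 0 <= x <= 1 -> ~ A x ->
  Iuv (fun y => Num.min 1 (psi y / psi x) *
     (lyapunov psi A alpha r0 c y - lyapunov psi A alpha r0 c x))
    (Num.max 0 (x - c)) (Num.min 1 (x + c)) <= - (4 * c).

Lemma exists_drift_threshold (psi : R -> R) (alpha : R) :
  0 < alpha -> C1_01 psi -> (forall z, 0 <= z <= 1 -> 0 < psi z) ->
  Iuv psi 0 1 = 1 -> exists C, drift_threshold psi alpha C.
Proof.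
move=> alpha0 C1 psi0 mass1.
have [cpsi [df cdf taylor]] := C1_01_taylor psi C1.
have bpsi := bm_continuous psi cpsi.
have bpsiV := bm_continuous _ (continuous_inv01 psi psi0 cpsi).
have [x0 x001 psimin] := EVT_min ler01 cpsi.
have m0 : 0 < psi x0 by apply: psi0; move: x001; rewrite in_itv.
set m := psi x0 in psimin m0.
have mpsi z : 0 <= z <= 1 -> m <= psi z by move=> z01; apply: psimin; rewrite in_itv.
have [_ [D dfD]] := bm_continuous df cdf.
have D0 : 0 <= D by apply: le_trans (dfD x0 x001).
(* [M] bounds the slope through the minimum [m] of [psi], [B] bounds the logarithmic derivative, and
   [theta] is the largest value with [M * theta <= 1 / 100]. *)
pose M := (alpha * m)^-1 + 1; pose B := D / m; pose theta := (100 * M)^-1.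
have am : 0 < (alpha * m)^-1 by rewrite invr_gt0 mulr_gt0.
have M0 : 0 < M by rewrite addr_gt0.
have theta0 : 0 < theta by rewrite invr_gt0 mulr_gt0.
have B0 : 0 <= B by rewrite divr_ge0// ltW.
(* The factor [m] is cancelled when the expansion is divided by [psi x >= m]. *)
have [|delta delta0 tay] := taylor (theta * m); first by rewrite mulr_gt0.
(* The three summands yield [c <= 1 / 2], [c <= delta] and [(B + 1)^2 * c <= theta]. *)
exists (2 + delta^-1 + (B + 1) ^+ 2 / theta) => c c0 Cc.
have d0 : 0 < delta^-1 by rewrite invr_gt0.
have b0 : 0 <= (B + 1) ^+ 2 / theta by rewrite divr_ge0 ?sqr_ge0// ltW.
have c_le k : k <= c^-1 -> k * c <= 1 by move=> h; rewrite -ler_pdivlMr// div1r.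
have c2 : c <= 2^-1 by have h : 2 * c <= 1 by [apply: c_le; lra]; lra.
have cd : c <= delta.
  have : delta^-1 * c <= 1 by apply: c_le; lra.
  by rewrite mulrC ler_pdivrMr// mul1r.
have cB : (B + 1) ^+ 2 * c <= theta.
  have : (B + 1) ^+ 2 / theta * c <= 1 by apply: c_le; lra.
  by rewrite mulrAC ler_pdivrMr// mul1r.
have sc : small_scale M B c theta.
  split => //; first by rewrite lerDr ltW.
  - by rewrite c0/=; lra.
  - by rewrite /theta invfM mulrCA divff ?mulr1// gt_eqF.
split; first by lra.
move=> A mA massA r0 r0P x x01 nAx.
have px := psi0 x x01.
apply: (lyapunov_drift psi A alpha bpsi bpsiV psi0 mass1 mA alpha0 massA M B c theta
  x (df x / psi x) sc x01 c2) => //.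
- rewrite normrM (gtr0_norm (x := (psi x)^-1)) ?invr_gt0// ler_pM//.
  + by rewrite invr_ge0 ltW.
  + by apply: dfD; rewrite in_itv.
  + by rewrite lef_pV2 ?posrE// mpsi.
- apply: le_trans (hit_slope_le_inv psi A alpha bpsi psi0 mass1 mA alpha0 massA m x m0 mpsi x01) _.
  by rewrite lerDl.
- move=> z z01 zc.
  have x01' : x \in `[0, 1] by rewrite in_itv.
  have z01' : z \in `[0, 1] by rewrite in_itv.
  have := tay x z x01' z01' (le_trans zc cd).
  have -> : psi z / psi x - 1 - df x / psi x * (z - x) =
      (psi z - psi x - df x * (z - x)) / psi x by field; rewrite gt_eqF.
  rewrite normrM (gtr0_norm (x := (psi x)^-1)) ?invr_gt0// ler_pdivrMr// => h.
  apply: (le_trans h); rewrite mulrAC ler_wpM2l ?mulr_ge0 ?(ltW theta0)//.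
  exact: mpsi.
- move=> y y01; apply: le_trans (ler_norm _) _.
  exact: (prim_hit_slope_le psi A bpsi bpsiV mA r0 y y01 r0P).
Qed.

(** The potential in the barrier ranges over [[0, 2 * r0]], whence [96 = 48 * 2]; as [c <= 1], the
    constant height is absorbed into the multiple of [c^-2]. *)
Lemma lyapunov_bounds (psi : R -> R) (A : set R) (alpha r0 c y : R) :
  0 < alpha -> 0 < c <= 1 -> `|prim (hit_slope psi A) y| <= r0 ->
  0 <= lyapunov psi A alpha r0 c y <= (96 * r0 + 576 / alpha) * c ^- 2.
Proof.
move=> a0 /andP[c0 c1]; rewrite ler_norml => /andP[p1 p2].
have c2 : 1 <= c ^- 2 by rewrite -invr1 lef_pV2 ?posrE ?exprn_gt0// expr_le1// ltW.
have al0 : 0 <= 576 / alpha by apply: divr_ge0; [exact: ler0n|exact: ltW].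
have H0 : 0 <= barrier psi A r0 c y.
  rewrite /barrier mulr_ge0// ?subr_ge0//.
  by rewrite mulr_ge0 ?ler0n//; lra.
have H1 : barrier psi A r0 c y <= 96 * r0 * c ^- 2.
  rewrite /barrier -(mulrA 48) mulrCA [leRHS]mulrC ler_wpM2l//; lra.
have H2 : 576 / alpha <= 576 / alpha * c ^- 2 by rewrite ler_peMr.
have H3 : 0 <= 96 * r0 * c ^- 2 by exact: le_trans H1.
rewrite /lyapunov /indic; case: (_ \in _); rewrite /= ?subrr ?mulr0 ?subr0 ?mulr1.
  by rewrite lexx/= [leRHS]mulrDl; exact: addr_ge0 H3 (le_trans al0 H2).
by rewrite addr_ge0//= [leRHS]mulrDl lerD.
Qed.

End threshold.

(** * From the uniform slope bound to the constant [L] *)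

Theorem theorem4p2 (R : realType) :
  exists (L : R -> R -> R) (C : (R -> R) -> R -> R),
  forall (r alpha : R), 1 <= r -> 0 < alpha -> alpha < 2^-1 ->
  forall psi : R -> R, density01 psi -> C1_01 psi ->
  (exists rho : R -> R, density01 rho /\ nearly_unimodal alpha r rho psi) ->
  forall (c : R) (n : nat), (0 < n)%N -> c^-1 = n%:R -> C psi alpha < c^-1 ->
  (max_hitting_time (mh_kernel psi c) (density_measure psi) alpha
     <= (L alpha r * c ^- 2)%:E)%E.
Proof.
(* The first two terms bound the Lyapunov function for [r0 = r^2 / alpha], in units of [c^-2]; the
   final [1] pays for rounding up to an integer. *)
exists (fun alpha r => 96 * (r ^+ 2 / alpha) + 576 / alpha + 1).
(* A threshold is selected by choice from [psi] and [alpha]; the default [0] is harmless, since one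
   exists for the densities considered. *)
exists (fun psi alpha => xget 0 [set C | drift_threshold psi alpha C]).
move=> r alpha r1 alpha0 _ psi dpsi C1 [rho [drho [urho ratio _]]] c n n0 cn Cc.
have c0 : 0 < c by rewrite -invr_gt0 cn ltr0n.
have [mpsi psi_ge0 _] := dpsi.
have psi0 z : 0 <= z <= 1 -> 0 < psi z.
  move=> z01; have zin : z \in `[0, 1] by rewrite in_itv.
  rewrite lt_neqAle psi_ge0// andbT eq_sym; apply/eqP => pz.
  have := ratio z zin; rewrite pz invr0 mulr0 => /andP[+ _].
  by rewrite leNgt invr_gt0 (lt_le_trans ltr01 r1).
have mass1 := density01_mass psi dpsi.
have [cpsi _] := C1_01_taylor psi C1.
have bpsi := bm_continuous psi cpsi.
have bpsiV := bm_continuous _ (continuous_inv01 psi psi0 cpsi).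
have : drift_threshold psi alpha (xget 0 [set C | drift_threshold psi alpha C]).
  have [C CP] := exists_drift_threshold psi alpha alpha0 C1 psi0 mass1.
  by apply: (@xgetPex _ 0 [set C | drift_threshold psi alpha C]); exists C.
move=> /(_ c c0 Cc) [c1 drift].
apply: ge_ereal_sup => _ [disp [Om [P [X [x [A [[x01 chain] mA A01 aA ->]]]]]]].
have massA : alpha <= target_mass psi A by rewrite -lee_fin -density_measureE.
have slope z : 0 <= z <= 1 -> `|hit_slope psi A z| <= r ^+ 2 / alpha.
  exact: (hit_slope_le_unimodal psi A alpha bpsi psi0 mass1 mA alpha0 massA r rho).
set r0 := r ^+ 2 / alpha in slope *.
have c01 : 0 < c <= 1 by rewrite c0.
have bounds y : 0 <= y <= 1 ->
    0 <= lyapunov psi A alpha r0 c y <= (96 * r0 + 576 / alpha) * c ^- 2.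
  move=> y01; apply: lyapunov_bounds => //.
  exact: (prim_hit_slope_le psi A bpsi bpsiV mA r0 y y01 slope).
set H := (96 * r0 + 576 / alpha) * c ^- 2 in bounds.
have H0 : 0 <= H.
  have zero01 : 0 <= (0 : R) <= 1 by rewrite lexx ler01.
  by have /andP[h1 h2] := bounds 0 zero01; exact: le_trans h2.
(* This integer is at most [H + 1], hence at most [H + c^-2] because [c <= 1]. *)
have HN : H <= (Num.trunc H).+1%:R by exact: ltW (truncnS_gt _).
apply: (@le_trans _ _ (Num.trunc H).+1%:R%:E).
  apply: (mh_expected_hitting_time_le psi c bpsi bpsiV c0 psi0 A
    (lyapunov psi A alpha r0 c) _ x disp Om P X mA _ _ _ _ chain).
  - exact: bm_lyapunov.
  - by move=> y /bounds /andP[-> h]; exact: le_trans HN.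
  - by move=> y Ay; rewrite /lyapunov indicE (mem_set Ay) subrr mulr0.
  - by move=> z z01 nAz; exact: drift.
have c2 : 1 <= c ^- 2 by rewrite -invr1 lef_pV2 ?posrE ?exprn_gt0// expr_le1// ltW.
rewrite lee_fin mulrDl mul1r -/H -natr1 lerD//.
by have /andP[] := truncn_itv H0.
Qed.
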